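(* For every cardinal $\kappa \geq \omega_2$, the standard Cohen algebra $\mathbb{C}_\kappa$ has a complete regular subalgebra of $\pi$-weight $\kappa$ which is not Cohen.
   Context: For a cardinal $\kappa$ that is infinite or $0$, $Fn(\kappa,2)$ is the set of functions from finite subsets of $\kappa$ into $2$, ordered by inclusion (the larger function is the stronger condition), and $\mathbb{C}_\kappa$ is the completion (associated complete Boolean algebra) of $Fn(\kappa,2)$; equivalently, it is the completion of the free Boolean algebra over $\kappa$ generators. $\mathbb{C}_\kappa$ is called the standard Cohen algebra of $\pi$-weight $\kappa$. A Boolean algebra is Cohen if its completion is isomorphic to a product of at most countably many standard Cohen algebras. A subalgebra $B$ of a Boolean algebra $D$ is regular if all infinite sums and products of subsets of $B$ that exist in $B$ are preserved in $D$; a complete regular subalgebra is a regular subalgebra that is itself a complete Boolean algebra. A subset $P$ of $D$ is dense in $D$ if for every $d \in D\setminus\{0\}$ there is $p \in P$ with $0 < p \leq d$. The $\pi$-weight $\pi(D)$ is the minimal size of a dense subset of $D$. *)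

(* Defs.v *)
From HB Require Import structures.
From mathcomp Require Import all_boot all_order finmap.
From mathcomp Require Import boolp classical_sets functions cardinality.

Set Implicit Arguments.
Unset Strict Implicit.
Unset Printing Implicit Defensive.

Import Order.TTheory.

Local Open Scope classical_set_scope.
Local Open Scope order_scope.
Local Open Scope card_scope.

(* Boolean algebras are the complemented distributive lattices of MathComp,
   [ctbDistrLatticeType d]; the degenerate algebra with 0 = 1 is allowed, and
   every type has a choiceType structure, classically. A cardinal is
   represented by any set (or full type) of that cardinality. *)

Definition card_lt T U (A : set T) (B : set U) : Prop :=
  A #<= B /\ ~ (B #<= A).

Definition is_succ_card T U (A : set T) (B : set U) : Prop :=
  card_lt A B /\ forall (V : Type) (C : set V), card_lt A C -> B #<= C.

Definition is_omega2 T (A : set T) : Prop :=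
  exists (U : Type) (W : set U),
    is_succ_card [set: nat] W /\ is_succ_card W A.

Definition omega2_le T (A : set T) : Prop :=
  exists (U : Type) (W : set U), is_omega2 W /\ W #<= A.

(* The completion of a poset [P], where [q <= p] means that [q] is the stronger
   condition: the algebra of regular open sets for the topology whose open sets
   are the down-sets. [ro_neg U] is the interior of the complement of [U], so
   that [ro_neg (ro_neg U)] is the interior of the closure of a down-set [U]. *)
Section RegularOpen.
Context {d : Order.disp_t} (P : porderType d).
Implicit Types (U V : set P) (p q r : P).

Definition ro_neg U : set P := [set p | forall q, q <= p -> ~ U q].

Definition regular_open U : Prop := ro_neg (ro_neg U) = U.

Definition down_closed U : Prop := forall p q, q <= p -> U p -> U q.

Lemma ro_neg_down U : down_closed (ro_neg U).
Proof. by move=> p q qp Up r rq; apply: Up; exact: le_trans qp. Qed.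

Lemma ro_neg2P U p :
  ro_neg (ro_neg U) p <-> forall q, q <= p -> exists2 r, r <= q & U r.
Proof.
split=> [nn q qp|H q qp nq].
  by have /existsNP[r /not_implyP[rq /contrapT Ur]] := nn _ qp; exists r.
by have [r rq Ur] := H _ qp; exact: nq Ur.
Qed.

Lemma sub_ro_neg2 U : down_closed U -> U `<=` ro_neg (ro_neg U).
Proof. by move=> dU p Up q qp nq; apply: (nq q) => //; exact: dU Up. Qed.

Lemma ro_negS U V : U `<=` V -> ro_neg V `<=` ro_neg U.
Proof. by move=> UV p Vp q qp /UV; exact: Vp. Qed.

Lemma regular_down U : regular_open U -> down_closed U.
Proof. by move=> <-; exact: ro_neg_down. Qed.

Lemma regular_neg U : down_closed U -> regular_open (ro_neg U).
Proof.
move=> dU; apply/seteqP; split; first by apply: ro_negS; exact: sub_ro_neg2.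
by apply: sub_ro_neg2; exact: ro_neg_down.
Qed.

Lemma down_closedU U V :
  down_closed U -> down_closed V -> down_closed (U `|` V).
Proof. by move=> dU dV p q qp [/(dU _ _ qp)|/(dV _ _ qp)]; [left|right]. Qed.

Lemma regularI U V : regular_open U -> regular_open V -> regular_open (U `&` V).
Proof.
move=> rU rV; apply/seteqP; split=> [p Hp|].
  by split; [rewrite -rU|rewrite -rV];
    apply: ro_negS Hp; apply: ro_negS => ? [].
by apply: sub_ro_neg2 => p q qp [Up Vp]; split;
  [exact: regular_down Up|exact: regular_down Vp].
Qed.

Record ro : Type := Ro { ro_set :> set P; _ : `[< regular_open ro_set >] }.

HB.instance Definition _ := [isSub for ro_set].
HB.instance Definition _ := [Choice of ro by <:].

Lemma roP (u : ro) : regular_open u.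
Proof. by case: u => U /= /asboolP. Qed.

Lemma ro_down (u : ro) : down_closed u.
Proof. exact: (regular_down (roP u)). Qed.

Definition mk_ro U (h : regular_open U) : ro := Ro (asboolT h).

End RegularOpen.

Fact ro_display : Order.disp_t. Proof. exact: Order.Disp tt tt. Qed.

Section RegularOpenAlgebra.
Context {d : Order.disp_t} (P : porderType d).
Implicit Types u v w : ro P.

Definition ro_le u v : bool := `[< (u : set P) `<=` v >].

Fact ro_le_refl : reflexive ro_le.
Proof. by move=> u; apply/asboolP. Qed.

Fact ro_le_anti : antisymmetric ro_le.
Proof.
by move=> u v /andP[/asboolP uv /asboolP vu]; apply/val_inj/seteqP.
Qed.

Fact ro_le_trans : transitive ro_le.
Proof.
by move=> v u w /asboolP uv /asboolP vw; apply/asboolP; exact: subset_trans vw.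
Qed.

HB.instance Definition _ := Order.Le_isPOrder.Build ro_display (ro P)
  ro_le_refl ro_le_anti ro_le_trans.

Lemma ro_leP u v : reflect ((u : set P) `<=` v) (u <= v).
Proof. exact: asboolP. Qed.

Definition ro_meet u v : ro P := mk_ro (regularI (roP u) (roP v)).

Fact ro_lexI u v w : (u <= ro_meet v w) = (u <= v) && (u <= w).
Proof.
apply/ro_leP/andP => [H|[/ro_leP uv /ro_leP uw] p up]; last first.
  by split; [exact: uv|exact: uw].
by split; apply/ro_leP => p /H[].
Qed.

HB.instance Definition _ :=
  Order.POrder_isMeetSemilattice.Build ro_display (ro P) ro_lexI.

Definition ro_join u v : ro P :=
  mk_ro (regular_neg (@ro_neg_down _ P ((u : set P) `|` v))).

Fact ro_leUx u v w : (ro_join u v <= w) = (u <= w) && (v <= w).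
Proof.
have dUV : down_closed ((u : set P) `|` v).
  by apply: down_closedU; exact: ro_down.
apply/ro_leP/andP => [H|[/ro_leP uw /ro_leP vw] p jp].
  by split; apply/ro_leP => p up; apply: H; apply: sub_ro_neg2 => //;
    [left|right].
rewrite -(roP w); apply: ro_negS jp; apply: ro_negS.
by move=> q [/uw|/vw].
Qed.

HB.instance Definition _ :=
  Order.POrder_isJoinSemilattice.Build ro_display (ro P) ro_leUx.

Fact ro_meetUl : left_distributive ro_meet ro_join.
Proof.
move=> u v w; apply: le_anti; apply/andP; split; last first.
  rewrite lexI !leUx; apply/andP; split; apply/andP; split.
  - exact: le_trans (leIl _ _) (leUl _ _).
  - exact: le_trans (leIl _ _) (leUr _ _).
  - exact: leIr.
  - exact: leIr.
apply/ro_leP => p [/ro_neg2P jp wp]; apply/ro_neg2P => q qp.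
have [r rq uvr] := jp _ qp; exists r => //.
have wr : (w : set P) r by apply: (@ro_down _ _ w p) => //; exact: le_trans qp.
by case: uvr => [ur|vr]; [left|right].
Qed.

HB.instance Definition _ :=
  Order.Lattice_Meet_isDistrLattice.Build ro_display (ro P) ro_meetUl.

Fact regular0 : regular_open (set0 : set P).
Proof.
apply/seteqP; split=> [p /ro_neg2P /(_ _ (lexx p))[]//|].
exact: sub0set.
Qed.

Fact regularT : regular_open (setT : set P).
Proof. by apply/seteqP; split=> // p _; apply/ro_neg2P => q _; exists q. Qed.

Definition ro_bot : ro P := mk_ro regular0.
Definition ro_top : ro P := mk_ro regularT.

Fact ro_le0x u : ro_bot <= u. Proof. by apply/ro_leP => p []. Qed.
Fact ro_lex1 u : u <= ro_top. Proof. by apply/ro_leP. Qed.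

HB.instance Definition _ := Order.hasBottom.Build ro_display (ro P) ro_le0x.
HB.instance Definition _ := Order.hasTop.Build ro_display (ro P) ro_lex1.

Definition ro_compl u : ro P := mk_ro (regular_neg (@ro_down _ _ u)).

Fact ro_joinxC u : u `|` ro_compl u = \top.
Proof.
apply: le_anti; rewrite lex1 /=; apply/ro_leP => p _; apply/ro_neg2P => q _.
have [[r rq ur]|nu] := pselect (exists2 r, r <= q & (u : set P) r).
  by exists r => //; left.
by exists q => //; right => r rq ur; apply: nu; exists r.
Qed.

Fact ro_meetxC u : u `&` ro_compl u = \bot.
Proof.
by apply: le_anti; rewrite le0x andbT; apply/ro_leP => p [up /(_ p (lexx p))].
Qed.

HB.instance Definition _ := Order.TBDistrLattice_hasComplement.Build
  ro_display (ro P) ro_joinxC ro_meetxC.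

End RegularOpenAlgebra.

(* The completion of a Boolean algebra is that of its poset of nonzero
   elements. *)
Definition nonzero d (D : ctbDistrLatticeType d) : Type :=
  {x : D | x != \bot}.

HB.instance Definition _ d (D : ctbDistrLatticeType d) :=
  SubChoice.on (@nonzero d D).
HB.instance Definition _ d (D : ctbDistrLatticeType d) :=
  [SubChoice_isSubPOrder of @nonzero d D by <: with d].

Definition completion d (D : ctbDistrLatticeType d) :
  ctbDistrLatticeType ro_display := ro (@nonzero d D).

(* Fn(K, 2), ordered so that [p <= q] means that [p] extends [q]. *)
Definition Fn (K : choiceType) : Type := {fmap K -> bool}.

Fact Fn_display : Order.disp_t. Proof. exact: Order.Disp tt tt. Qed.

Section Fn.
Variable K : choiceType.
Implicit Types p q : Fn K.

HB.instance Definition _ := Choice.on (Fn K).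

Definition Fn_le p q : bool :=
  `[< forall k b, q.[? k]%fmap = Some b -> p.[? k]%fmap = Some b >].

Fact Fn_le_refl : reflexive Fn_le.
Proof. by move=> p; apply/asboolP. Qed.

Fact Fn_le_anti : antisymmetric Fn_le.
Proof.
move=> p q /andP[/asboolP pq /asboolP qp]; apply/fmapP => k.
case Ep : (p.[? k])%fmap => [b|]; first by rewrite (qp _ _ Ep).
by case Eq : (q.[? k])%fmap => [b|//]; rewrite (pq _ _ Eq) in Ep.
Qed.

Fact Fn_le_trans : transitive Fn_le.
Proof.
by move=> q p r /asboolP pq /asboolP qr; apply/asboolP => k b /qr /pq.
Qed.

HB.instance Definition _ := Order.Le_isPOrder.Build Fn_display (Fn K)
  Fn_le_refl Fn_le_anti Fn_le_trans.

End Fn.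

Definition cohen_algebra (K : choiceType) : ctbDistrLatticeType ro_display :=
  ro (Fn K).

Definition prod_algebra d (I : Type) (D : I -> ctbDistrLatticeType d) : Type :=
  forall i, D i.

Section Product.
Context {d : Order.disp_t} (I : Type) (D : I -> ctbDistrLatticeType d).
Local Notation T := (prod_algebra D).
Implicit Types f g h : T.

HB.instance Definition _ := gen_eqMixin T.
HB.instance Definition _ := gen_choiceMixin T.

Definition prod_le f g : bool := `[< forall i, f i <= g i >].

Fact prod_le_refl : reflexive prod_le.
Proof. by move=> f; apply/asboolP. Qed.

Fact prod_le_anti : antisymmetric prod_le.
Proof.
move=> f g /andP[/asboolP fg /asboolP gf]; apply: functional_extensionality_dep.
by move=> i; apply: le_anti; rewrite fg gf.
Qed.

Fact prod_le_trans : transitive prod_le.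
Proof.
move=> g f h /asboolP fg /asboolP gh; apply/asboolP => i.
exact: le_trans (gh i).
Qed.

HB.instance Definition _ := Order.Le_isPOrder.Build d T
  prod_le_refl prod_le_anti prod_le_trans.

Definition prod_meet f g : T := fun i => f i `&` g i.
Definition prod_join f g : T := fun i => f i `|` g i.

Fact prod_lexI f g h : (f <= prod_meet g h) = (f <= g) && (f <= h).
Proof.
apply/asboolP/andP => [H|[/asboolP fg /asboolP fh] i].
  by split; apply/asboolP => i; move: (H i); rewrite lexI => /andP[].
by rewrite lexI fg fh.
Qed.

Fact prod_leUx f g h : (prod_join f g <= h) = (f <= h) && (g <= h).
Proof.
apply/asboolP/andP => [H|[/asboolP fg /asboolP fh] i].
  by split; apply/asboolP => i; move: (H i); rewrite leUx => /andP[].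
by rewrite leUx fg fh.
Qed.

HB.instance Definition _ :=
  Order.POrder_isMeetSemilattice.Build d T prod_lexI.
HB.instance Definition _ :=
  Order.POrder_isJoinSemilattice.Build d T prod_leUx.

Fact prod_meetUl : left_distributive prod_meet prod_join.
Proof.
by move=> f g h; apply: functional_extensionality_dep => i; exact: meetUl.
Qed.

HB.instance Definition _ :=
  Order.Lattice_Meet_isDistrLattice.Build d T prod_meetUl.

Fact prod_le0x f : ((fun=> \bot) : T) <= f.
Proof. by apply/asboolP => i; exact: le0x. Qed.

Fact prod_lex1 f : f <= ((fun=> \top) : T).
Proof. by apply/asboolP => i; exact: lex1. Qed.

HB.instance Definition _ := Order.hasBottom.Build d T prod_le0x.
HB.instance Definition _ := Order.hasTop.Build d T prod_lex1.

Definition prod_compl f : T := fun i => ~` f i.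

Fact prod_joinxC f : f `|` prod_compl f = \top.
Proof. by apply: functional_extensionality_dep => i; exact: Order.CTBDistrLatticeTheory.joinxC. Qed.

Fact prod_meetxC f : f `&` prod_compl f = \bot.
Proof. by apply: functional_extensionality_dep => i; exact: Order.CTBDistrLatticeTheory.meetxC. Qed.

HB.instance Definition _ :=
  Order.TBDistrLattice_hasComplement.Build d T prod_joinxC prod_meetxC.

End Product.

Definition isomorphic d1 d2 (A : ctbDistrLatticeType d1)
    (B : ctbDistrLatticeType d2) : Prop :=
  exists f : A -> B,
    [/\ bijective f,
        {morph f : x y / x `&` y >-> x `&` y},
        {morph f : x y / x `|` y >-> x `|` y} &
        {morph f : x / ~` x >-> ~` x}].

Definition is_cohen d (B : ctbDistrLatticeType d) : Prop :=
  exists (I : countType) (K : I -> choiceType),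
    (forall i, infinite_set [set: K i] \/ [set: K i] = set0) /\
    isomorphic (completion B) (prod_algebra (fun i => cohen_algebra (K i))).

Record subalgebra d (D : ctbDistrLatticeType d) : Type := Subalgebra {
  subalg_set :> set D;
  subalg0 : \bot \in subalg_set;
  subalg1 : \top \in subalg_set;
  subalgI : meet_closed (mem subalg_set);
  subalgU : join_closed (mem subalg_set);
  subalgC : forall x, x \in subalg_set -> ~` x \in subalg_set }.

Definition subalg_type d (D : ctbDistrLatticeType d) (B : subalgebra D) :=
  {x : D | x \in subalg_set B}.

Section Subalgebra.
Context {d : Order.disp_t} (D : ctbDistrLatticeType d) (B : subalgebra D).
Local Notation T := (subalg_type B).

HB.instance Definition _ := SubChoice.on T.
HB.instance Definition _ := Order.SubChoice_isTBSubLattice.Build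
  d D _ d T (@subalgI _ _ B) (@subalgU _ _ B) (@subalg0 _ _ B) (@subalg1 _ _ B).

Fact sub_meetUl : left_distributive (@Order.meet d T) (@Order.join d T).
Proof. by move=> x y z; apply: val_inj; exact: meetUl. Qed.

HB.instance Definition _ :=
  Order.Lattice_Meet_isDistrLattice.Build d T sub_meetUl.

Definition sub_compl (x : T) : T := exist _ (~` val x) (subalgC (valP x)).

Fact sub_joinxC x : x `|` sub_compl x = \top.
Proof. by apply: val_inj; exact: Order.CTBDistrLatticeTheory.joinxC. Qed.

Fact sub_meetxC x : x `&` sub_compl x = \bot.
Proof. by apply: val_inj; exact: Order.CTBDistrLatticeTheory.meetxC. Qed.

HB.instance Definition _ :=
  Order.TBDistrLattice_hasComplement.Build d T sub_joinxC sub_meetxC.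

End Subalgebra.

Definition subalg d (D : ctbDistrLatticeType d) (B : subalgebra D) :
  ctbDistrLatticeType d := subalg_type B.

(* [supremums S s] and [infimums S s] say that [s] is the sum, respectively the
   product, of [S] in the ambient algebra. *)
Definition regular_subalgebra d (D : ctbDistrLatticeType d)
    (B : subalgebra D) : Prop :=
  forall (S : set (subalg B)) (s : subalg B),
    (supremums S s -> supremums (val @` S) (val s)) /\
    (infimums S s -> infimums (val @` S) (val s)).

Definition complete_algebra d (D : ctbDistrLatticeType d) : Prop :=
  forall S : set D, supremums S !=set0 /\ infimums S !=set0.

Definition dense_in d (D : ctbDistrLatticeType d) (P : set D) : Prop :=
  forall x, x != \bot -> exists p, [/\ P p, \bot < p & p <= x].

Definition is_pi_weight d (D : ctbDistrLatticeType d) T (A : set T) : Prop :=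
  (exists P : set D, dense_in P /\ P #= A) /\
  (forall P : set D, dense_in P -> A #<= P).

(* Main.v *)
Require Import Defs.
From mathcomp Require Import all_boot all_order finmap.
From mathcomp Require Import boolp classical_sets functions cardinality.

Set Implicit Arguments.
Unset Strict Implicit.
Unset Printing Implicit Defensive.

Import Order.TTheory.

Local Open Scope classical_set_scope.
Local Open Scope order_scope.
Local Open Scope card_scope.

(** The subalgebra adjoins a family of partial functions [x_s] from [nat] to
    [bool], for [s] in [K], any two of which agree at all but finitely many of
    their common points. A condition [p] decides finitely many [x_s] below a
    length [m] and promises that from [m] on these finitely many functions
    never contradict each other.

    Such a family exists in the Cohen extension: take a hidden Cohen real [r]
    and let [x_s] be arbitrary up to a generic stopping time [k_s] and a
    restriction of [r] to a generic set afterwards. Forgetting [r] and the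
    [k_s] projects a dense set of Cohen conditions onto the coherent conditions
    ([coh_projection]); the regular open sets that are saturated for the
    projection form a complete regular subalgebra ([projected_complete],
    [projected_regular]) in which the coherent conditions are dense
    ([projected_cond_embedding]). A dense set must mention every [s], so the
    pi-weight is the cardinal of [K] ([coh_pi_weight]).

    It is not Cohen, because neither [r] nor any substitute for it is visible
    in the subalgebra. In a product of Cohen algebras, parts of a condition [q]
    over two sets [S] and [T] of coordinates can be strengthened separately,
    inside [S] and inside [T], and the results stay compatible with [q] as soon
    as they are compatible with each other ([prod_amalgam]). In the coherent
    poset this fails whenever [S] contains [a] but not [b] and [T] contains [b]
    but not [a] ([coh_split]): let [u] promise that [x_a] and [x_b] never
    contradict each other. Below [u], a condition over [S] may still define
    [x_a] as false at a new point and a condition over [T] may define [x_b] as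
    true there. These two are compatible, but not below [u]. If both posets
    were dense in one algebra, countable Skolem hulls would match countable
    sets of coordinates on the two sides ([countable_closed]), and since [K]
    has at least [omega_2] elements some [a] and [b] lie outside each other's
    hull ([free_pair]); so the two behaviours would contradict each other
    ([no_common_completion]). *)

(** * Cardinal arithmetic *)

Lemma card_le_of_inj T U (A : set T) (B : set U) (f : T -> U) :
  (forall x, A x -> B (f x)) ->
  (forall x y, A x -> A y -> f x = f y -> x = y) -> A #<= B.
Proof.
move=> fAB finj.
have /injfunPex[g] : exists2 g : T -> U, set_fun A B g & set_inj A g.
  by exists f => // x y /set_mem Ax /set_mem Ay; exact: finj.
exact: inj_card_le g.
Qed.

Lemma inj_of_card_le T U (A : set T) (B : set U) (u0 : U) : A #<= B ->
  exists f : T -> U, (forall x, A x -> B (f x)) /\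
    (forall x y, A x -> A y -> f x = f y -> x = y).
Proof.
move=> /card_leP[f].
pose h x := if pselect (A x) is left Ax
  then val (f (SigSub (mem_set Ax))) else u0.
exists h; split=> [x Ax|x y Ax Ay]; rewrite /h.
  by case: pselect => // Ax'; exact: set_valP.
case: pselect => // Ax'; case: pselect => // Ay' /val_inj/inj.
by rewrite !inE => /(_ I I) /(congr1 val).
Qed.

(** A maximal partial injection is total or onto. *)
Lemma card_le_total T U (A : set T) (B : set U) : A #<= B \/ B #<= A.
Proof.
pose P := [set G : set (T * U) | [/\ forall a b, G (a, b) -> A a /\ B b,
  forall a b b', G (a, b) -> G (a, b') -> b = b' &
  forall a a' b, G (a, b) -> G (a', b) -> a = a']].
have [|G [[GAB Gfun Ginj] Gmax]] := @Zorn_bigcup _ P.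
  move=> F FP Ftot; split=> [a b [G FG Gab]|a b b'|a a' b].
  - by have [H _ _] := FP _ FG; exact: H Gab.
  - move=> [G FG Gab] [G' FG' Gab'].
    have [/(_ _ Gab) Gab2|/(_ _ Gab') Gab2] := Ftot _ _ FG FG'.
      by have [_ H _] := FP _ FG'; exact: H Gab2 Gab'.
    by have [_ H _] := FP _ FG; exact: H Gab Gab2.
  - move=> [G FG Gab] [G' FG' Gab'].
    have [/(_ _ Gab) Gab2|/(_ _ Gab') Gab2] := Ftot _ _ FG FG'.
      by have [_ _ H] := FP _ FG'; exact: H Gab2 Gab'.
    by have [_ _ H] := FP _ FG; exact: H Gab Gab2.
have [Adom|/existsNP[a /not_implyP[Aa nGa]]] :=
    pselect (forall a, A a -> exists b, G (a, b)).
  left; have [[a Aa]|nA] := pselect (A !=set0); last first.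
    by rewrite (_ : A = set0) ?card_ge0//; apply: contra_notP nA => /eqP/set0P.
  have [b _] := Adom a Aa.
  have /choice[f fP] : forall a, exists b, A a -> G (a, b).
    move=> a'; have [/Adom[b' Gb']|nA] := pselect (A a'); first by exists b'.
    by exists b.
  apply: (card_le_of_inj (f := f)) => [x /fP /GAB[]//|x y /fP + /fP + fxy].
  by rewrite fxy; exact: Ginj.
have [Bdom|/existsNP[b /not_implyP[Bb nGb]]] :=
    pselect (forall b, B b -> exists a, G (a, b)).
  right.
  have /choice[f fP] : forall b, exists a, B b -> G (a, b).
    move=> b'; have [/Bdom[a' Ga']|nB] := pselect (B b'); first by exists a'.
    by exists a.
  apply: (card_le_of_inj (f := f)) => [x /fP /GAB[]//|x y /fP + /fP + fxy].
  by rewrite fxy; exact: Gfun.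
exfalso; apply: (Gmax (G `|` [set (a, b)])).
  split; first by move=> x; left.
  by move=> /(_ (a, b)) H; apply: nGa; exists b; apply: H; right.
split=> [a' b' [/GAB//|[-> ->]//]|a' b1 b2|a1 a2 b'].
- move=> [G1|[Ea Eb]] [G2|[Ea' Eb']]; first exact: Gfun G1 G2.
  + by case: nGa; exists b1; rewrite -Ea'.
  + by case: nGa; exists b2; rewrite -Ea.
  + by rewrite Eb Eb'.
- move=> [G1|[Ea Eb]] [G2|[Ea' Eb']]; first exact: Ginj G1 G2.
  + by case: nGb; exists a1; rewrite -Eb'.
  + by case: nGb; exists a2; rewrite -Eb.
  + by rewrite Ea Ea'.
Qed.

(** Injections of [X * X] into [X], for subsets [X] of [K], are encoded by
    their graphs, so that they are ordered by inclusion of sets of triples;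
    [X] is then read off the diagonal. *)
Section Hessenberg.
Variables (K : Type) (K_infinite : infinite_set [set: K]).

Let field (G : set (K * K * K)) : set K := [set a | exists c, G (a, a, c)].

Let square_injection (G : set (K * K * K)) : Prop :=
  [/\ forall a b c, G (a, b, c) -> [/\ field G a, field G b & field G c],
      forall a b, field G a -> field G b -> exists c, G (a, b, c),
      forall a b c c', G (a, b, c) -> G (a, b, c') -> c = c' &
      forall a b a' b' c, G (a, b, c) -> G (a', b', c) -> a = a' /\ b = b'].

Let square_injection_bigcup (F : set (set (K * K * K))) :
  F `<=` square_injection -> total_on F subset ->
  square_injection (\bigcup_(G in F) G).
Proof.
move=> FP Ftot.
have field_sub G : F G -> field G `<=` field (\bigcup_(G in F) G).
  by move=> FG a [c Gc]; exists c; exists G.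
have join G G' : F G -> F G' -> exists G'', [/\ F G'', G `<=` G'' & G' `<=` G''].
  move=> FG FG'; have [GG|GG] := Ftot _ _ FG FG'; first by exists G'; split.
  by exists G; split.
split.
- move=> a b c [G FG Gabc]; have [+ _ _ _] := FP _ FG.
  by move=> /(_ _ _ _ Gabc)[? ? ?]; split; exact: field_sub FG _ _.
- move=> a b [c [G FG Ga]] [c' [G' FG' Gb]].
  have [G'' [F'' s s']] := join _ _ FG FG'.
  have [_ tot _ _] := FP _ F''.
  have [d Gd] : exists d, G'' (a, b, d).
    by apply: tot; [exists c; exact: s|exists c'; exact: s'].
  by exists d; exists G''.
- move=> a b c c' [G FG Gc] [G' FG' Gc'].
  have [G'' [F'' /(_ _ Gc) H1 /(_ _ Gc') H2]] := join _ _ FG FG'.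
  by have [_ _ H _] := FP _ F''; exact: H H1 H2.
- move=> a b a' b' c [G FG Gc] [G' FG' Gc'].
  have [G'' [F'' /(_ _ Gc) H1 /(_ _ Gc') H2]] := join _ _ FG FG'.
  by have [_ _ _ H] := FP _ F''; exact: H H1 H2.
Qed.

Let square_injection_nat :
  exists G, square_injection G /\ exists x0 x1, [/\ field G x0, field G x1 & x0 <> x1].
Proof.
have /infiniteP := K_infinite => natK.
have [x _] := infinite_setN0 K_infinite.
have [i [_ iinj]] := inj_of_card_le x natK.
have {}iinj m n : i m = i n -> m = n by exact: iinj.
pose G := [set t : K * K * K | exists m n : nat,
  t = (i m, i n, i (choice.pickle (m, n)))].
have fG m : field G (i m).
  by exists (i (choice.pickle (m, m))); exists m, m.
exists G; split; last first.
  by exists (i 0), (i 1); split => // /iinj.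
split.
- by move=> a b c [m [n [-> -> ->]]]; split.
- move=> a b [c [m [? [-> _ _]]]] [c' [n [? [-> _ _]]]].
  by exists (i (choice.pickle (m, n))); exists m, n.
- move=> a b c c' [m [n [-> -> ->]]] [m' [n' [/iinj-> /iinj-> ->]]].
  by [].
- move=> a b a' b' c [m [n [-> -> ->]]] [m' [n' [-> ->]]].
  by move=> /iinj /(pcan_inj choice.pickleK) [-> ->].
Qed.

(** Take a maximal graph, with field [X]. If the complement of [X] injects into
    [X], so does [K], by two disjoint copies of [X] inside [X * X], and the
    injection for [X] transfers to [K]. Otherwise a copy of [X] lies in the
    complement, and the injection extends to the union of [X] and this copy,
    with its new values in the copy. *)
Lemma infinite_square_inj : exists f : K * K -> K, injective f.
Proof.
have [G0 [G0P [y0 [y1 [Gy0 Gy1 y01]]]]] := square_injection_nat.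
pose P := [set G | square_injection G /\ (G = set0 \/ G0 `<=` G)].
have [|G [[GP G0G] Gmax]] := @Zorn_bigcup _ P.
  move=> F FP Ftot; split.
    by apply: square_injection_bigcup => // G /FP[].
  have [[G [FG nG]]|all0] := pselect (exists G, F G /\ G <> set0).
    right=> t G0t; exists G => //; have [_ [//|G0G]] := FP _ FG.
    exact: G0G.
  left; apply/seteqP; split=> // t [G FG Gt].
  have G0' : G <> set0 by move=> E; rewrite E in Gt.
  by case: all0; exists G.
have {}G0G : G0 `<=` G.
  case: G0G => // GE; exfalso; apply: (Gmax G0); last by split => //; right.
  rewrite GE; split=> // /(_ (y0, y0, _)); case: Gy0 => c Gc.
  by move=> /(_ _ Gc).
pose X := field G.
have Xy0 : X y0 by case: Gy0 => c /G0G; exists c.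
have Xy1 : X y1 by case: Gy1 => c /G0G; exists c.
have [Gfield Gtot Gfun Ginj] := GP.
have /choice[f fG] : forall t : K * K, exists c, X t.1 -> X t.2 ->
    G (t.1, t.2, c).
  move=> [a b] /=; have [[Xa Xb]|nX] := pselect (X a /\ X b).
    by have [c Gc] := Gtot a b Xa Xb; exists c.
  by exists y0 => Xa Xb; case: nX.
have fX a b : X a -> X b -> X (f (a, b)).
  by move=> Xa Xb; have [] := Gfield _ _ _ (fG (a, b) Xa Xb).
have finj a b a' b' : X a -> X b -> X a' -> X b' -> f (a, b) = f (a', b') ->
    a = a' /\ b = b'.
  move=> Xa Xb Xa' Xb' E; have := fG (a', b') Xa' Xb'; rewrite -E.
  exact: Ginj (fG (a, b) Xa Xb).
pose y (b : bool) := if b then y1 else y0.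
have Xy b : X (y b) by case: b.
have yinj : injective y.
  by case; case=> //= E; case: y01.
have [XleC|CleX] := card_le_total X (~` X); last first.
  have [g [gX ginj]] := inj_of_card_le y0 CleX.
  pose h k := if `[< X k >] then f (y true, k) else f (y false, g k).
  have hX k : X (h k).
    by rewrite /h; case: asboolP => Xk; apply: fX => //; exact: gX.
  have hinj : injective h.
    move=> k l; rewrite /h; case: asboolP => Xk; case: asboolP => Xl.
    - by move=> E; have [] := finj _ _ _ _ (Xy _) Xk (Xy _) Xl E.
    - move=> E; have [/yinj//] := finj _ _ _ _ (Xy _) Xk (Xy _) (gX _ Xl) E.
    - move=> E; have [/yinj//] := finj _ _ _ _ (Xy _) (gX _ Xk) (Xy _) Xl E.
    - move=> E; have [_] := finj _ _ _ _ (Xy _) (gX _ Xk) (Xy _) (gX _ Xl) E.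
      exact: ginj.
  exists (fun t => f (h t.1, h t.2)) => -[a b] [a' b'] E.
  by have [/hinj /= -> /hinj /= ->] := finj _ _ _ _ (hX _) (hX _) (hX _) (hX _) E.
exfalso; have [g [gX ginj]] := inj_of_card_le y0 XleC.
pose X' := X `|` g @` X.
have /choice[base baseP] : forall a, exists x, X' a ->
    X x /\ a = if `[< X a >] then x else g x.
  move=> a; have [[Xa|[x Xx <-]]|nX'] := pselect (X' a).
  - by exists a => _; case: asboolP.
  - by exists x => _; case: asboolP => // /(gX _ Xx).
  - by exists y0.
have baseX a : X' a -> X (base a) by move=> /baseP[].
(* Two bits and two elements of [X] code a pair from the enlarged field. *)
pose code a b := f (f (y `[< X a >], y `[< X b >]), f (base a, base b)).
have codeX a b : X' a -> X' b -> X (code a b).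
  by move=> /baseX Xa /baseX Xb; exact: fX (fX _ _ _ _) (fX _ _ _ _).
have code_inj a b a' b' : X' a -> X' b -> X' a' -> X' b' ->
    code a b = code a' b' -> a = a' /\ b = b'.
  move=> Xa Xb Xa' Xb' E; move: (baseX _ Xa) (baseX _ Xb) (baseX _ Xa') (baseX _ Xb').
  move=> ba bb ba' bb'.
  have [] := finj _ _ _ _ (fX _ _ (Xy _) (Xy _)) (fX _ _ ba bb)
    (fX _ _ (Xy _) (Xy _)) (fX _ _ ba' bb') E.
  move=> E1 E2; have [/yinj Ea /yinj Eb] :=
    finj _ _ _ _ (Xy _) (Xy _) (Xy _) (Xy _) E1.
  have [Ba Bb] := finj _ _ _ _ ba bb ba' bb' E2.
  have [_ ->] := baseP _ Xa; have [_ ->] := baseP _ Xb.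
  have [_ ->] := baseP _ Xa'; have [_ ->] := baseP _ Xb'.
  by rewrite Ea Eb Ba Bb.
pose G' := [set t : K * K * K | G t \/
  [/\ X' t.1.1, X' t.1.2, ~ (X t.1.1 /\ X t.1.2) & t.2 = g (code t.1.1 t.1.2)]].
have XX' : X `<=` X' by move=> a; left.
have gX' a : X a -> X' (g a) by move=> Xa; right; exists a.
have fieldE : field G' = X'.
  apply/seteqP; split=> [a [c [Gc|[]//]]|a X'a].
    by left; exists c.
  have [[c Gc]|nXa] := pselect (X a); first by exists c; left.
  by exists (g (code a a)); right; split => // -[].
apply: (Gmax G').
  split=> [t Gt|sub]; first by left.
  have : X' (g y0) by exact: gX'.
  rewrite -fieldE => -[c /sub Gc]; apply: (gX _ Xy0).
  by exists c.
split; last by right=> t /G0G; left.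
split.
- rewrite fieldE => a b c [/Gfield[]|[/= X'a X'b _ ->]]; first by split; left.
  by split => //; exact/gX'/codeX.
- rewrite fieldE => a b X'a X'b.
  have [[Xa Xb]|nX] := pselect (X a /\ X b).
    by have [c Gc] := Gtot _ _ Xa Xb; exists c; left.
  by exists (g (code a b)); right.
- move=> a b c c' [Gc|[/= ? ? nX ->]] [Gc'|[/= ? ? nX' ->]] //.
  + exact: Gfun Gc Gc'.
  + by case: nX'; have [] := Gfield _ _ _ Gc.
  + by case: nX; have [] := Gfield _ _ _ Gc'.
- move=> a b a' b' c [Gc|[/= Xa Xb nX ->]] [Gc'|[/= Xa' Xb' nX' E]].
  + exact: Ginj Gc Gc'.
  + have [_ _] := Gfield _ _ _ Gc.
    by rewrite E => /(gX _ (codeX _ _ Xa' Xb')).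
  + have [_ _] := Gfield _ _ _ Gc'.
    by move=> /(gX _ (codeX _ _ Xa Xb)).
  + by apply: code_inj => //; apply: ginj E; exact: codeX.
Qed.

End Hessenberg.

Lemma infinite_nat_inj (K : Type) : infinite_set [set: K] ->
  exists i : nat -> K, injective i.
Proof.
move=> Kinf; have [x _] := infinite_setN0 Kinf.
have /infiniteP/(inj_of_card_le x)[i [_ iinj]] := Kinf.
by exists i => m n; exact: iinj.
Qed.

(** Lists are coded by iterating a pairing function, with a tag that separates
    the empty list from the others. *)
Lemma infinite_seq_inj (K : Type) : infinite_set [set: K] ->
  exists f : seq K * nat -> K, injective f.
Proof.
move=> Kinf; have [i iinj] := infinite_nat_inj Kinf.
have [f finj] := infinite_square_inj Kinf.
pose e := foldr (fun x y => f (i 1, f (x, y))) (f (i 0, i 0)).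
have einj : injective e.
  elim=> [|x s IH] [|y t] //= /finj[].
  - by move=> /iinj.
  - by move=> /iinj.
  - by move=> /finj[-> /IH ->].
exists (fun t => f (e t.1, i t.2)) => -[s m] [t n] /finj[].
by move=> /einj/= -> /iinj/= ->.
Qed.

(** A Skolem hull. The elements [a] are determined by the finite list [supp a]
    and the natural number [code a], so the requirement on [F a] is closure
    under countably many finitary operations, and the hull is the set of values
    of the countably many terms in these operations. *)
Lemma countable_hull (X : choiceType) (A : Type) (supp : A -> seq X)
    (code : A -> nat) (F : A -> seq X) (x0 : X) :
  injective (fun a => (supp a, code a)) ->
  exists H : set X, [/\ H x0, countable H &
    forall a, (forall x, x \in supp a -> H x) -> forall x, x \in F a -> H x].
Proof.
move=> supp_inj.
(* The index [n] encodes the pair of [code a] and of a position in [F a]. *)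
pose op n (l : seq X) :=
  if pselect (exists a, supp a = l /\
      exists j : nat, choice.pickle (code a, j) = n) is left aP
  then nth x0 (F (projT1 (cid aP)))
         (oapp snd 0 (choice.unpickle n : option (nat * nat))) else x0.
have opE a j : op (choice.pickle (code a, j)) (supp a) = nth x0 (F a) j.
  rewrite /op; case: pselect => [aP|[]]; last by exists a; split => //; exists j.
  rewrite choice.pickleK /=; case: cid => b /= [Eb [j']].
  by move=> /(pcan_inj choice.pickleK)[Ec _]; rewrite (supp_inj b a) ?Eb ?Ec.
pose eval := fix eval (t : GenTree.tree unit) : X :=
  if t is GenTree.Node n ts then op n (map eval ts) else x0.
exists (range eval); split.
- by exists (GenTree.Leaf tt).
- by apply: sub_countable (countableP [set: GenTree.tree unit]); exact: card_image_le.
- move=> a suppH x /(nthP x0)[j _ <-]; rewrite -opE.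
  have [ts <-] : exists ts, map eval ts = supp a.
    elim: (supp a) suppH => [|y s IH] H; first by exists [::].
    have [|ts <-] := IH; first by move=> z zs; apply: H; rewrite inE zs orbT.
    have [t _ <-] := H y (mem_head _ _); by exists (t :: ts).
  by exists (GenTree.Node (choice.pickle (code a, j)) ts).
Qed.

Lemma omega2_le_infinite (K : Type) :
  omega2_le [set: K] -> infinite_set [set: K].
Proof.
move=> [U2 [W2 [[U1 [W1 [[[n1 _] _] [[le12 _] _]]]] le2]]].
exact/infiniteP/(card_le_trans n1)/(card_le_trans le12).
Qed.

(** The hulls of [omega_1] many points cover at most [omega_1] points, so some
    [b] is outside all of them; the countable hull of [b] misses one of the
    [omega_1] points. *)
Lemma free_pair (K : Type) (H : K -> set K) :
  omega2_le [set: K] -> (forall k, countable (H k)) ->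
  exists a b, ~ H a b /\ ~ H b a.
Proof.
move=> K2 Hc; have Kinf := omega2_le_infinite K2.
have [k0 _] := infinite_setN0 Kinf.
move: K2 => [U2 [W2 [[U1 [W1 [[[n1 n1'] _] [[le12 le12'] _]]]] le2]]].
have [f [_ finj]] := inj_of_card_le k0 (card_le_trans le12 le2).
have [[b bP]|nb] := pselect (exists b, forall u, W1 u -> ~ H (f u) b).
  have [[u [W1u nHu]]|nu] := pselect (exists u, W1 u /\ ~ H b (f u)).
    by exists (f u), b; split => //; exact: bP.
  case: n1'; apply: card_le_trans (Hc b).
  apply: (card_le_of_inj (f := f)) => // u W1u.
  by apply: contrapT => nHu; apply: nu; exists u.
case: le12'; apply: card_le_trans le2 _.
have W1inf : infinite_set [set: W1].
  by apply/infiniteP; rewrite (card_le_eqr (card_setT _)).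
have [g ginj] := infinite_square_inj W1inf.
have [i iinj] := infinite_nat_inj W1inf.
have /choice[e einj] : forall k, exists e : K -> nat,
    forall x y, H k x -> H k y -> e x = e y -> x = y.
  by move=> k; have [e [_ einj]] := inj_of_card_le 0 (Hc k); exists e.
have /choice[u uP] : forall b, exists u : W1, H (f (val u)) b.
  move=> b; apply: contrapT => nu; apply: nb; exists b => u W1u Hu.
  by apply: nu; exists (SigSub (mem_set W1u)).
rewrite -(card_le_eqr (card_setT _)).
apply: (card_le_of_inj (f := fun b => g (u b, i (e (f (val (u b))) b)))) => //.
move=> b c _ _ /ginj[Eu /iinj]; rewrite -Eu; apply: einj; first exact: uP.
by rewrite Eu; exact: uP.
Qed.

(** * Systems of conditions with finite supports *)

(** A preorder of finite conditions with supports in [X]. [restr S p] is the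
    part of [p] inside [S]; by the last axiom its extensions inside [S] are
    compatible with [p]. The natural number [code p] completes the support to a
    description of [p]. *)
Record conditions (X : choiceType) := Conditions {
  cond :> Type;
  ext : cond -> cond -> Prop;
  keys : cond -> seq X;
  code : cond -> nat;
  restr : set X -> cond -> cond;
  ext_refl : forall p, ext p p;
  ext_trans : forall q p r, ext p q -> ext q r -> ext p r;
  keys_code_inj : injective (fun p => (keys p, code p));
  keys_restr : forall S p x, x \in keys (restr S p) -> S x;
  ext_restr : forall S p, ext p (restr S p);
  restr_mono : forall S p q, ext q p -> (forall x, x \in keys p -> S x) ->
    ext (restr S q) p;
  restr_amalgam : forall S p q, ext q (restr S p) ->
    exists r, ext r p /\ ext r (restr S q) }.
Arguments keys_restr {X c S p x}.
Arguments ext_restr {X c}.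
Arguments restr_mono {X c S p q}.
Arguments restr_amalgam {X c S p q}.
Arguments ext_trans {X c q p r}.

Definition supported X (P : conditions X) (S : set X) (p : P) : Prop :=
  forall x, x \in keys p -> S x.

(** A dense embedding presents the completion of an algebra as that of a
    preorder. The last axiom stands for the implication from [e p <= e q] to
    [le p q], which fails when [le] is not separative. *)
Section DenseEmbedding.
Context (P : Type) (le : P -> P -> Prop) d (D : ctbDistrLatticeType d).

Record dense_embedding (e : P -> D) : Prop := DenseEmbedding {
  emb_mono : forall p q, le p q -> e p <= e q;
  emb_neq0 : forall p, e p != \bot;
  emb_dense : forall x : D, x != \bot -> exists p, e p <= x;
  emb_compat : forall p q, e p `&` e q != \bot ->
    exists r, le r p /\ le r q }.

End DenseEmbedding.

Section Support.
Context (X : choiceType) (P : conditions X) d (D : ctbDistrLatticeType d).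
Variables (e : P -> D) (eP : dense_embedding (@ext X P) e).

(** What elementarity of [S] would give for the parameter [x]. *)
Definition closed_for (S : set X) (x : D) : Prop :=
  forall p, supported S p -> (exists q, ext q p /\ e q `&` x = \bot) ->
  exists q, [/\ ext q p, e q `&` x = \bot & supported S q].

(** If [e (restr S p)] were not below [x], some [g] below [restr S p] would be
    incompatible with [x]. By closure there is then such a [g] supported in
    [S]; but that one is compatible with [p], which is below [x]. *)
Lemma emb_supported S x p : closed_for S x -> e p <= x -> e (restr S p) <= x.
Proof.
move=> Scl px; apply: contrapT => npx.
have nz : e (restr S p) `&` ~` x != \bot.
  apply: contra_notN npx => /eqP E; rewrite -(meetx1 (e (restr S p))).
  by rewrite -(Order.CTBDistrLatticeTheory.joinxC x) meetUr E joinx0 leIr.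
have [g0 g0le] := emb_dense eP nz.
have [|g [gg0 gp]] := emb_compat eP (p := g0) (q := restr S p).
  rewrite (meet_l (le_trans g0le (leIl _ _))).
  exact: (emb_neq0 eP).
have gx : e g `&` x = \bot.
  apply/le_anti; rewrite le0x andbT -(Order.CTBDistrLatticeTheory.meetxC x) meetC.
  rewrite lexI leIl /=; apply: le_trans (leIr _ _) _.
  by apply: le_trans (emb_mono eP gg0) _; apply: le_trans g0le (leIr _ _).
have gSp : ext (restr S g) (restr S p).
  by apply: restr_mono gp _ => y; exact: keys_restr.
have [|g' [g'g g'x g'S]] := Scl (restr S g) (fun y => keys_restr).
  by exists g; split => //; exact: ext_restr.
have [r [rp rg']] := restr_amalgam (ext_trans g'g gSp).
have rg'' : ext r g' := ext_trans rg' (restr_mono (ext_refl g') g'S).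
have := emb_neq0 eP r; rewrite -lex0 -g'x lexI (emb_mono eP rg'') /=.
by rewrite (le_trans (emb_mono eP rp) px).
Qed.

End Support.

Section Incompatibility.
Context (X Y : choiceType) (P : conditions X) (Q : conditions Y).
Context d (D : ctbDistrLatticeType d).
Variables (e : P -> D) (eP : dense_embedding (@ext X P) e).
Variables (f : Q -> D) (fQ : dense_embedding (@ext Y Q) f).

(** The Skolem functions pick, for a condition of one preorder and a condition
    of the other, an extension of either one incompatible with the other. *)
Lemma countable_closed (a : X) : exists (S : set X) (T : set Y),
  [/\ S a, countable S,
      forall q, supported T q -> closed_for e S (f q) &
      forall p, supported S p -> closed_for f T (e p)].
Proof.
have /choice[skP skPP] : forall t : P * Q, exists p',
    (exists q, ext q t.1 /\ e q `&` f t.2 = \bot) ->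
    ext p' t.1 /\ e p' `&` f t.2 = \bot.
  move=> t; have [[p' pP]|nP] := pselect (exists q, ext q t.1 /\
    e q `&` f t.2 = \bot); first by exists p'.
  by exists t.1.
have /choice[skQ skQP] : forall t : P * Q, exists q',
    (exists q, ext q t.2 /\ f q `&` e t.1 = \bot) ->
    ext q' t.2 /\ f q' `&` e t.1 = \bot.
  move=> t; have [[p' pP]|nP] := pselect (exists q, ext q t.2 /\
    f q `&` e t.1 = \bot); first by exists p'.
  by exists t.2.
(* A pair of conditions has its support in the disjoint union, and the size
   stored in its code tells where the list splits. *)
pose kk (p : P) (q : Q) : seq (X + Y) := map inl (keys p) ++ map inr (keys q).
have kkl p q x : (inl x \in kk p q) = (x \in keys p).
  rewrite mem_cat mem_map; last by move=> ? ? [].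
  by rewrite [X in _ || X](_ : _ = false) ?orbF//; apply/negP => /mapP[].
have kkr p q x : (inr x \in kk p q) = (x \in keys q).
  rewrite mem_cat orbC mem_map; last by move=> ? ? [].
  by rewrite [X in _ || X](_ : _ = false) ?orbF//; apply/negP => /mapP[].
have [|H [Ha Hc Hcl]] := @countable_hull (X + Y)%type (P * Q)%type
  (fun t => kk t.1 t.2)
  (fun t => choice.pickle (code t.1, code t.2, size (keys t.1)))
  (fun t => kk (skP t) (skQ t)) (inl a).
  move=> [p q] [p' q'] /= [+ /(pcan_inj choice.pickleK)[cp cq sz]].
  move=> /eqP; rewrite eqseq_cat ?size_map//.
  move=> /andP[/eqP/inj_map kp /eqP/inj_map kq].
  have -> : p = p'.
    by apply: keys_code_inj; rewrite cp kp // => ? ? [].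
  have -> // : q = q'.
  by apply: keys_code_inj; rewrite cq kq // => ? ? [].
exists [set x | H (inl x)], [set y | H (inr y)].
have Hcl' p q : supported [set x | H (inl x)] p ->
    supported [set y | H (inr y)] q -> forall z, z \in kk (skP (p, q)) (skQ (p, q)) -> H z.
  move=> pS qT; apply: Hcl => /= -[x|y].
    by rewrite kkl; exact: pS.
  by rewrite kkr; exact: qT.
split=> //.
- apply: card_le_trans Hc; apply: (card_le_of_inj (f := inl)) => // x y _ _.
  by case.
- move=> q qT p pS /(skPP (p, q))[pp pq].
  exists (skP (p, q)); split => // x xk.
  by apply: (Hcl' p q pS qT); rewrite kkl.
- move=> p pS q qT /(skQP (p, q))[pp pq].
  exists (skQ (p, q)); split => // x xk.
  by apply: (Hcl' p q pS qT); rewrite kkr.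
Qed.

(** Let [u] be as in the splitting hypothesis for hulls of [a] and [b], with
    [p] below [q] below [u]. The extensions [p1] and [p2] lie below the two
    parts of [q], and the parts in the hulls of a common extension of [p1] and
    [p2] in [Q] still lie below [p1] and [p2]. By amalgamation these parts are
    compatible with [q], hence with [u], against the choice of [p1] and
    [p2]. *)
Lemma no_common_completion : omega2_le [set: X] ->
  (forall S T a b, S a -> ~ T a -> T b -> ~ S b -> exists u : P,
     forall p, ext p u -> exists p1 p2,
     [/\ supported S p1 /\ supported T p2,
         ext p1 (restr S p), ext p2 (restr T p),
         exists r, ext r p1 /\ ext r p2 &
         forall r, ext r p1 -> ext r p2 -> ~ ext r u]) ->
  (forall S T (q r : Q), ext r (restr S q) -> ext r (restr T q) ->
     exists z, [/\ ext z q, ext z (restr S r) & ext z (restr T r)]) ->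
  False.
Proof.
move=> X2 splitP amalgQ.
have /choice[ST STP] : forall a, exists ST : set X * set Y,
  [/\ ST.1 a, countable ST.1,
      forall q, supported ST.2 q -> closed_for e ST.1 (f q) &
      forall p, supported ST.1 p -> closed_for f ST.2 (e p)].
  by move=> a; have [S [T ?]] := countable_closed a; exists (S, T).
have [|a [b []]] := @free_pair X (fun a => (ST a).1) X2.
  by move=> a; have [] := STP a.
have [] := STP a; have [] := STP b.
move: (ST a) (ST b) => [S S'] [T T'] /= Tb _ Te Tf Sa _ Se Sf nSb nTa.
have [u uP] := splitP S T a b Sa nTa Tb nSb.
have [q qu] := emb_dense fQ (emb_neq0 eP u).
have [p0 p0q] := emb_dense eP (emb_neq0 fQ q).
have [|p [pp0 pu]] := emb_compat eP (p := p0) (q := u).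
  by rewrite (meet_l (le_trans p0q qu)); exact: (emb_neq0 eP).
have pq : e p <= f q by apply: le_trans (emb_mono eP pp0) p0q.
have [p1 [p2 [[p1S p2T] p1p p2p [r0 [r0p1 r0p2]] nu]]] := uP p pu.
have sup W (z : Q) : supported W (restr W z) by move=> y; exact: keys_restr.
have p1q : e p1 <= f (restr S' q).
  apply: le_trans (emb_mono eP p1p) _; apply: (emb_supported eP) (Se _ (sup _ _)) _.
  by apply: le_trans pq _; exact/(emb_mono fQ)/ext_restr.
have p2q : e p2 <= f (restr T' q).
  apply: le_trans (emb_mono eP p2p) _; apply: (emb_supported eP) (Te _ (sup _ _)) _.
  by apply: le_trans pq _; exact/(emb_mono fQ)/ext_restr.
have [r1 r1r0] := emb_dense fQ (emb_neq0 eP r0).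
have below (z w : Q) : f z <= f w -> exists z', ext z' z /\ ext z' w.
  move=> zw; apply: (emb_compat fQ); rewrite (meet_l zw); exact: (emb_neq0 fQ).
have r1p1 := le_trans r1r0 (emb_mono eP r0p1).
have r1p2 := le_trans r1r0 (emb_mono eP r0p2).
have [r2 [r2r1 r2q]] := below _ _ (le_trans r1p1 p1q).
have [r [rr2 rq]] := below _ _ (le_trans (emb_mono fQ r2r1) (le_trans r1p2 p2q)).
have rr1 := ext_trans rr2 r2r1.
have [z [zq zS zT]] := amalgQ _ _ _ _ (ext_trans rr2 r2q) rq.
have zp1 : f z <= e p1.
  apply: le_trans (emb_mono fQ zS) _; apply: (emb_supported fQ) (Sf _ p1S) _.
  exact: le_trans (emb_mono fQ rr1) r1p1.
have zp2 : f z <= e p2.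
  apply: le_trans (emb_mono fQ zT) _; apply: (emb_supported fQ) (Tf _ p2T) _.
  exact: le_trans (emb_mono fQ rr1) r1p2.
have zu := le_trans (emb_mono fQ zq) qu.
have [w wz] := emb_dense eP (emb_neq0 fQ z).
have belowP (p' p'' : P) : e p' <= e p'' -> exists v, ext v p' /\ ext v p''.
  move=> zw; apply: (emb_compat eP); rewrite (meet_l zw); exact: (emb_neq0 eP).
have [w1 [w1w w1p1]] := belowP _ _ (le_trans wz zp1).
have w1z := le_trans (emb_mono eP w1w) wz.
have [w2 [w2w1 w2p2]] := belowP _ _ (le_trans w1z zp2).
have w2z := le_trans (emb_mono eP w2w1) w1z.
have [w3 [w3w2 w3u]] := belowP _ _ (le_trans w2z zu).
exact: nu (ext_trans (ext_trans w3w2 w2w1) w1p1) (ext_trans w3w2 w2p2) w3u.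
Qed.

End Incompatibility.

(** * Subalgebras induced by a projection of posets *)

(** [proj c p] says that [c] belongs to a dense set of conditions that are
    mapped to a preorder, and that [p] is the image of [c]. Every extension of
    the image can be refined by the image of an extension of [c], so that
    pulling back along [proj] preserves complements. *)
Record projection {d} (C : porderType d) (P : Type) (le : P -> P -> Prop)
    (proj : C -> P -> Prop) : Prop := Projection {
  proj_trans : forall q p r, le p q -> le q r -> le p r;
  proj_dense : forall c, exists c' p, c' <= c /\ proj c' p;
  proj_mono : forall c c' p p', c' <= c -> proj c p -> proj c' p' -> le p' p;
  proj_lift : forall c p p', proj c p -> le p' p ->
    exists c' p'', [/\ c' <= c, proj c' p'' & le p'' p'];
  proj_surj : forall p, exists c p', proj c p' /\ le p' p }.

Section ProjectedSubalgebra.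
Context {d} (C : porderType d) (P : Type) (le : P -> P -> Prop).
Variables (proj : C -> P -> Prop) (projP : projection le proj).

Definition saturated (U : set C) : Prop := forall c c' p p',
  proj c p -> proj c' p' -> le p' p -> U c -> U c'.

Definition projected : set (ro C) := [set U | saturated (U : ro C)].

(** An element of [U] below [c'] has an image stronger than that of [c];
    lifting this image gives an extension of [c], which is in [U] because [U]
    is saturated. *)
Lemma saturated_neg (U : set C) :
  down_closed U -> saturated U -> saturated (ro_neg U).
Proof.
move=> dU Usat c c' p p' cp c'p' p'p nUc c1 c1c' Uc1.
have [c2 [p2 [c2c1 c2p2]]] := proj_dense projP c1.
have p2p' := proj_mono projP (le_trans c2c1 c1c') c'p' c2p2.
have [c3 [p3 [c3c c3p3 p3p2]]] :=
  proj_lift projP cp (proj_trans projP p2p' p'p).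
apply: nUc c3c _; apply: Usat c2p2 c3p3 p3p2 _.
exact: dU c2c1 Uc1.
Qed.

Lemma projected0 : \bot \in projected.
Proof. by rewrite inE => ? ? ? ? _ _ _ []. Qed.

Lemma projectedC U : U \in projected -> ~` U \in projected.
Proof. by rewrite !inE; apply: saturated_neg; exact: ro_down. Qed.

Lemma projectedI : meet_closed (mem projected).
Proof.
move=> U V; rewrite !inE => sU sV c c' p p' cp cp' p'p [Uc Vc].
by split; [exact: sU cp cp' p'p Uc|exact: sV cp cp' p'p Vc].
Qed.

Lemma projected1 : \top \in projected.
Proof. by rewrite inE. Qed.

Lemma projectedU : join_closed (mem projected).
Proof.
move=> U V sU sV.
rewrite -[_ `|` _]Order.CTBDistrLatticeTheory.complK.
rewrite Order.CTBDistrLatticeTheory.complU.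
by apply: projectedC; apply: projectedI; exact: projectedC.
Qed.

Definition projected_subalgebra : subalgebra (ro C : ctbDistrLatticeType _) :=
  Subalgebra projected0 projected1 projectedI projectedU projectedC.

Local Notation B := (subalg projected_subalgebra).

Lemma mem_projected (U : B) : saturated (val U : ro C).
Proof. by have := valP U; rewrite inE. Qed.

Definition mk_projected (U : ro C) (sU : saturated U) : B :=
  exist _ U (mem_set (sU : projected U)).

Lemma regular_bigcap (F : set (ro C)) :
  regular_open (\bigcap_(U in F) (U : set C)).
Proof.
apply/seteqP; split=> [c Hc U FU|].
  by rewrite -(roP U); apply: ro_negS Hc; apply: ro_negS; exact: bigcap_inf.
by apply: sub_ro_neg2 => c c' c'c Hc U FU; exact: ro_down c'c (Hc U FU).
Qed.

Definition ro_inf (F : set (ro C)) : ro C := mk_ro (regular_bigcap F).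

Lemma ro_inf_infimum F : infimums F (ro_inf F).
Proof.
split=> [U FU|V VF]; first by apply/ro_leP => c /(_ U FU).
by apply/ro_leP => c Vc U FU; have /ro_leP := VF U FU; exact.
Qed.

Lemma infimum_neg (F : set (ro C)) (U : ro C) :
  infimums [set ~` V | V in F] U -> supremums F (~` U).
Proof.
move=> [lU gU]; split=> [V FV|V VF].
  rewrite -[V]Order.CTBDistrLatticeTheory.complK.
  by rewrite Order.CTBDistrLatticeTheory.leC; apply: lU; exists V.
rewrite -[V]Order.CTBDistrLatticeTheory.complK Order.CTBDistrLatticeTheory.leC.
by apply: gU => _ [W FW <-]; rewrite Order.CTBDistrLatticeTheory.leC; exact: VF.
Qed.

Lemma saturated_inf (F : set (ro C)) : F `<=` projected -> saturated (ro_inf F).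
Proof.
move=> FP c c' p p' cp cp' p'p Fc U FU; exact: FP FU _ _ _ _ cp cp' p'p (Fc U FU).
Qed.

(** Bounds computed in the large algebra are saturated, so they are also the
    bounds in the subalgebra; completeness and regularity both follow. *)
Lemma projected_infimum (F : set B) : exists U : B,
  infimums F U /\ infimums [set (val V : ro C) | V in F] (val U).
Proof.
have FP : [set (val V : ro C) | V in F] `<=` projected.
  by move=> _ [V _ <-]; exact: mem_projected.
exists (mk_projected (saturated_inf FP)).
have [lU gU] := ro_inf_infimum [set (val V : ro C) | V in F].
split; last by split.
split=> [V FV|V VF]; rewrite -Order.le_val; first by apply: lU; exists V.
by apply: gU => _ [W FW <-]; rewrite Order.le_val; exact: VF.
Qed.

Lemma projected_supremum (F : set B) : exists U : B,
  supremums F U /\ supremums [set (val V : ro C) | V in F] (val U).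
Proof.
have [U [_ UF]] := projected_infimum [set ~` V | V in F].
have sF : supremums [set (val V : ro C) | V in F] (~` (val U : ro C)).
  apply: infimum_neg; congr (infimums _ _): UF.
  apply/seteqP; split=> [_ [_ [V FV <-] <-]|_ [_ [V FV <-] <-]].
    by exists (val V) => //; exists V.
  by exists (~` V) => //; exists V.
exists (~` U); split => //; case: sF => uU lU.
split=> [V FV|V VF]; rewrite -Order.le_val; first by apply: uU; exists V.
by apply: lU => _ [W FW <-]; rewrite Order.le_val; exact: VF.
Qed.

Lemma projected_complete : complete_algebra B.
Proof.
move=> F; have [U [UF _]] := projected_supremum F.
by have [V [VF _]] := projected_infimum F; split; [exists U|exists V].
Qed.

Lemma projected_regular : regular_subalgebra projected_subalgebra.
Proof.
move=> F U; split=> [[uU lU]|[lU gU]].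
  have [V [[uV lV] VF]] := projected_supremum F.
  by suff -> : U = V by []; apply: le_anti; rewrite lU// lV.
have [V [[lV gV] VF]] := projected_infimum F.
by suff -> : U = V by []; apply: le_anti; rewrite gU// gV.
Qed.

(** The regular open set generated by the Cohen conditions whose image extends
    [p]. *)
Definition projected_cond_set (p : P) : set C :=
  [set c | exists c' p', [/\ c <= c', proj c' p' & le p' p]].

Lemma projected_cond_down p : down_closed (projected_cond_set p).
Proof.
move=> c c' c'c [c1 [p1 [cc1 c1p1 p1p]]]; exists c1, p1; split => //.
exact: le_trans cc1.
Qed.

Lemma projected_cond_saturated p :
  saturated (ro_neg (ro_neg (projected_cond_set p))).
Proof.
move=> c c' q q' cq c'q' q'q /ro_neg2P pc; apply/ro_neg2P => c1 c1c'.
have [c2 [p2 [c2c1 c2p2]]] := proj_dense projP c1.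
have p2q' := proj_mono projP (le_trans c2c1 c1c') c'q' c2p2.
have [c3 [p3 [c3c c3p3 p3p2]]] :=
  proj_lift projP cq (proj_trans projP p2q' q'q).
have [c4 c4c3 [c5 [p5 [c4c5 c5p5 p5p]]]] := pc _ c3c.
have [c6 [p6 [c6c4 c6p6]]] := proj_dense projP c4.
have p6p5 := proj_mono projP (le_trans c6c4 c4c5) c5p5 c6p6.
have p6p3 := proj_mono projP (le_trans c6c4 c4c3) c3p3 c6p6.
have [c7 [p7 [c7c2 c7p7 p7p6]]] :=
  proj_lift projP c2p2 (proj_trans projP p6p3 p3p2).
exists c7; first exact: le_trans c2c1.
exists c7, p7; split => //.
exact: (proj_trans projP) p7p6 (proj_trans projP p6p5 p5p).
Qed.

Definition projected_cond (p : P) : B :=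
  @mk_projected (mk_ro (regular_neg (@ro_neg_down _ C (projected_cond_set p))))
    (@projected_cond_saturated p).

Lemma ro_neq0 (U : ro C) : U != \bot <-> exists c, (U : set C) c.
Proof.
split=> [U0|[c Uc]]; last by apply/eqP => E; rewrite E in Uc.
apply: contrapT => nU; case/eqP: U0; apply/val_inj/seteqP.
by split=> // c Uc; case: nU; exists c.
Qed.

Lemma projected_neq0 (U : B) :
  U != \bot <-> exists c p, proj c p /\ ((val U : ro C) : set C) c.
Proof.
have -> : (U != \bot) = ((val U : ro C) != \bot) by [].
rewrite ro_neq0; split=> [[c Uc]|[c [p [_ Uc]]]]; last by exists c.
have [c' [p [c'c c'p]]] := proj_dense projP c.
by exists c', p; split => //; exact: ro_down Uc.
Qed.

Lemma projected_cond_embedding : dense_embedding le projected_cond.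
Proof.
split.
- move=> p q pq; rewrite -Order.le_val; apply/ro_leP; apply: ro_negS; apply: ro_negS.
  move=> c [c' [p' [cc' c'p' p'p]]]; exists c', p'; split => //.
  exact: (proj_trans projP) pq.
- move=> p; apply/projected_neq0; have [c [p' [cp' p'p]]] := proj_surj projP p.
  exists c, p'; split => //; apply: sub_ro_neg2; first exact: projected_cond_down.
  by exists c, p'.
- move=> U /projected_neq0[c [p [cp Uc]]]; exists p.
  rewrite -Order.le_val; apply/ro_leP; rewrite -[X in _ `<=` X]roP.
  apply: ro_negS; apply: ro_negS => c1 [c2 [p2 [c1c2 c2p2 p2p]]].
  by apply: ro_down c1c2 _; exact: mem_projected cp c2p2 p2p Uc.
- move=> p q /projected_neq0[c [r [cr [/ro_neg2P pc /ro_neg2P qc]]]].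
  have [c1 c1c [c2 [p2 [c1c2 c2p2 p2p]]]] := pc _ (lexx _).
  have [c3 c3c1 [c4 [p4 [c3c4 c4p4 p4q]]]] := qc _ c1c.
  have [c5 [p5 [c5c3 c5p5]]] := proj_dense projP c3.
  exists p5; split.
    apply: (proj_trans projP) p2p; apply: (proj_mono projP _ c2p2 c5p5).
    exact: le_trans c5c3 (le_trans c3c1 c1c2).
  apply: (proj_trans projP) p4q; apply: (proj_mono projP _ c4p4 c5p5).
  exact: le_trans c5c3 c3c4.
Qed.

End ProjectedSubalgebra.

(** * Completions, isomorphic copies and finite maps *)

Section Transfer.
Context (P : Type) (le : P -> P -> Prop).

Lemma principal_down d (C : porderType d) (c : C) : down_closed [set x | x <= c].
Proof. by move=> x y yx; exact: le_trans. Qed.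

Definition ro_principal d (C : porderType d) (c : C) : ro C :=
  mk_ro (regular_neg (@ro_neg_down _ C [set x | x <= c])).

Lemma ro_principal_embedding d (C : porderType d) :
  dense_embedding (fun x y : C => x <= y) (@ro_principal d C).
Proof.
split.
- move=> x y xy; apply/ro_leP; apply: ro_negS; apply: ro_negS => z /= zx.
  exact: le_trans xy.
- move=> x; apply/ro_neq0; exists x; apply: sub_ro_neg2; first exact: principal_down.
  exact: lexx.
- move=> U /ro_neq0[x Ux]; exists x; apply/ro_leP; rewrite -[X in _ `<=` X]roP.
  by apply: ro_negS; apply: ro_negS => y /= yx; exact: ro_down Ux.
- move=> x y /ro_neq0[z [/ro_neg2P xz /ro_neg2P yz]].
  have [z1 z1z z1x] := xz _ (lexx _).
  have [z2 z2z1 z2y] := yz _ z1z.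
  by exists z2; split => //; exact: le_trans z1x.
Qed.

(** The completion is built on the nonzero elements, among which the image of a
    dense embedding is dense. *)
Lemma completion_embedding d (D : ctbDistrLatticeType d) (e : P -> D) :
  dense_embedding le e -> exists f : P -> completion D, dense_embedding le f.
Proof.
move=> eP; pose e' p : nonzero D := exist _ (e p) (emb_neq0 eP p).
have prP := ro_principal_embedding (nonzero D).
exists (fun p => ro_principal (e' p)); split.
- move=> p q pq; apply: (emb_mono prP); rewrite -Order.le_val.
  exact: emb_mono eP _ _ pq.
- move=> p; exact: (emb_neq0 prP).
- move=> U /(emb_dense prP)[x xU]; have [p px] := emb_dense eP (valP x).
  exists p; apply: le_trans xU; apply: (emb_mono prP); rewrite -Order.le_val.
  exact: px.
- move=> p q /(emb_compat prP)[z [zp zq]]; apply: (emb_compat eP).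
  have zpq : val z <= e p `&` e q.
    by rewrite lexI; apply/andP; split; [move: zp|move: zq]; rewrite -Order.le_val.
  apply/eqP => E; rewrite E lex0 in zpq; have := valP z.
  by rewrite zpq.
Qed.

Lemma isomorphic_embedding d1 d2 (A : ctbDistrLatticeType d1)
    (B : ctbDistrLatticeType d2) (e : P -> A) :
  isomorphic A B -> dense_embedding le e ->
  exists f : P -> B, dense_embedding le f.
Proof.
move=> [h [hbij hI hU hC]] eP; have hinj := bij_inj hbij.
have hle x y : (h x <= h y) = (x <= y) by rewrite !leEmeet -hI (inj_eq hinj).
have h0 : h \bot = \bot.
  rewrite -(Order.CTBDistrLatticeTheory.meetxC (\bot : A)) hI hC.
  exact: Order.CTBDistrLatticeTheory.meetxC.
have hneq0 x : (h x != \bot) = (x != \bot) by rewrite -h0 (inj_eq hinj).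
exists (h \o e); split=> /=.
- by move=> p q pq; rewrite hle; exact: (emb_mono eP).
- by move=> p; rewrite hneq0; exact: (emb_neq0 eP).
- move=> y; have [g _ gh] := hbij; rewrite -[y]gh hneq0 => /(emb_dense eP)[p py].
  by exists p; rewrite hle.
- by move=> p q; rewrite -hI hneq0; exact: (emb_compat eP).
Qed.

End Transfer.

Section FiniteMaps.
Context (K : choiceType) (V : Type).

(** The finite map that agrees with [g] on [s]; keys where [g] is undefined are
    dropped. *)
Definition fmap_of (s : seq K) (g : K -> option V) : {fmap K -> V} :=
  foldr (fun k f => if g k is Some v then f.[k <- v]%fmap else f) [fmap]%fmap s.

Lemma fnd_fmap_of s g k :
  (fmap_of s g).[? k]%fmap = if k \in s then g k else None.
Proof.
elim: s => [|x s IH] /=; first by rewrite fnd_fmap0.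
case E: (g x) => [v|]; rewrite ?fnd_set inE; case: eqVneq => [Ekx|nkx] //=.
- by rewrite Ekx E.
- by rewrite IH Ekx E if_same.
Qed.

Lemma mem_domf (f : {fmap K -> V}) k : (k \in domf f) = isSome f.[? k]%fmap.
Proof. by rewrite fndSome. Qed.

Lemma mem_fmap_of s g k :
  (k \in domf (fmap_of s g)) = (k \in s) && isSome (g k).
Proof. by rewrite mem_domf fnd_fmap_of; case: ifP. Qed.

Lemma fnd_none (f : {fmap K -> V}) k : k \notin domf f -> f.[? k]%fmap = None.
Proof. exact: not_fnd. Qed.

End FiniteMaps.

Lemma fmap_keys_values_inj (K : choiceType) (V : Type) (f g : {fmap K -> V}) :
  enum_fset (domf f) = enum_fset (domf g) ->
  [seq f.[? k]%fmap | k <- enum_fset (domf f)] =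
  [seq g.[? k]%fmap | k <- enum_fset (domf g)] -> f = g.
Proof.
move=> E; rewrite E => /eq_in_map H; apply/fmapP => k.
have [kg|nkg] := boolP (k \in enum_fset (domf g)); first exact: H.
by rewrite !fnd_none // -[_ \in _]/(_ \in enum_fset _) E.
Qed.

(** * Conditions in products of Cohen algebras *)

Section ProductConditions.
Context (I : countType) (K : I -> choiceType).

Local Notation X := {i & K i}.
(** A pair [(i, f)] stands for the element that is [f] at the factor [i] and
    zero elsewhere. The keys of [f] are taken in the disjoint union of all
    [K i], which avoids dependent pairs; only those over [i] are meaningful, and
    [prod_ext] ignores the others. *)
Definition prod_cond : Type := I * {fmap X -> bool}.
Implicit Types (q r : prod_cond) (S T : set X) (x : X).

Definition prod_ext r q : Prop := r.1 = q.1 /\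
  forall x b, tag x = q.1 -> q.2.[? x]%fmap = Some b -> r.2.[? x]%fmap = Some b.

Definition prod_restr S q : prod_cond :=
  (q.1, fmap_of (enum_fset (domf q.2))
          (fun x => if `[< S x >] then q.2.[? x]%fmap else None)).

Lemma prod_restrE S q x :
  ((prod_restr S q).2.[? x] = if `[< S x >] then q.2.[? x] else None)%fmap.
Proof.
rewrite fnd_fmap_of; case: ifPn => // xq.
by rewrite fnd_none ?if_same.
Qed.

(** Follow [r] on the union of [S] and [T], and [q] outside. *)
Lemma prod_amalgam S T q r :
  prod_ext r (prod_restr S q) -> prod_ext r (prod_restr T q) ->
  exists z, [/\ prod_ext z q, prod_ext z (prod_restr S r) &
                prod_ext z (prod_restr T r)].
Proof.
move=> [/= rq rS] [_ /= rT].
pose z : prod_cond := (q.1,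
  fmap_of (enum_fset (domf q.2) ++ enum_fset (domf r.2))
    (fun x => if `[< S x \/ T x >] then r.2.[? x] else q.2.[? x])%fmap).
have zE x : (z.2.[? x] = if `[< S x \/ T x >] then r.2.[? x] else q.2.[? x])%fmap.
  rewrite fnd_fmap_of mem_cat; case: ifPn => // /norP[xq xr].
  by rewrite !fnd_none ?if_same.
exists z; split; split => //= x b xt; rewrite (zE x).
- move=> qx; case: asboolP => // -[Sx|Tx]; [apply: rS|apply: rT] => //.
    by rewrite prod_restrE asboolT.
  by rewrite prod_restrE asboolT.
- rewrite -[fmap_of _ _]/((prod_restr S r).2) prod_restrE.
  by case: asboolP => // Sx; rewrite asboolT//; left.
- rewrite -[fmap_of _ _]/((prod_restr T r).2) prod_restrE.
  by case: asboolP => // Tx; rewrite asboolT//; right.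
Qed.

Lemma prod_ext_refl q : prod_ext q q.
Proof. by split. Qed.

Lemma prod_ext_trans r q s : prod_ext q r -> prod_ext r s -> prod_ext q s.
Proof.
move=> [qr1 qr] [rs1 rs]; split=> [|x b xs sx]; first by rewrite qr1.
by apply: qr; [rewrite rs1|exact: rs].
Qed.

Definition prod_code q : nat :=
  choice.pickle (q.1, [seq q.2.[? x]%fmap | x <- enum_fset (domf q.2)]).

Lemma prod_keys_code_inj :
  injective (fun q => (enum_fset (domf q.2), prod_code q)).
Proof.
move=> [i f] [j g] [/= E] /(pcan_inj choice.pickleK) /= [-> H].
by congr (_, _); exact: fmap_keys_values_inj.
Qed.

Lemma prod_keys_restr S q x : x \in enum_fset (domf (prod_restr S q).2) -> S x.
Proof.
rewrite -[_ \in _]/(_ \in domf _) mem_domf prod_restrE.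
by case: asboolP.
Qed.

Lemma prod_ext_restr S q : prod_ext q (prod_restr S q).
Proof. by split=> // x b _; rewrite prod_restrE; case: ifP. Qed.

Lemma prod_restr_mono S q r : prod_ext r q ->
  (forall x, x \in enum_fset (domf q.2) -> S x) -> prod_ext (prod_restr S r) q.
Proof.
move=> [rq1 rq] qS; split=> // x b xq qx.
rewrite prod_restrE asboolT; first exact: rq.
by apply: qS; rewrite -[_ \in _]/(_ \in domf _) mem_domf qx.
Qed.

Lemma prod_restr_amalgam S q r : prod_ext r (prod_restr S q) ->
  exists z, prod_ext z q /\ prod_ext z (prod_restr S r).
Proof. by move=> rS; have [z [? ? _]] := prod_amalgam rS rS; exists z. Qed.

Definition prod_conditions : conditions X :=
  Conditions prod_ext_refl prod_ext_trans prod_keys_code_inj prod_keys_restr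
    prod_ext_restr prod_restr_mono prod_restr_amalgam.

Definition prod_cond_set q j : set (Fn (K j)) := [set g : {fmap K j -> bool} | j = q.1 /\
  forall (k : K j) b, q.2.[? Tagged K k]%fmap = Some b -> g.[? k]%fmap = Some b].

(** Where [g] does not have the value required by [q], it can be extended by
    the opposite value, so it is not in the regularization. *)
Lemma prod_cond_regular q j : regular_open (@prod_cond_set q j).
Proof.
have dU : down_closed (@prod_cond_set q j).
  move=> g g' /asboolP g'g [jq gq]; split=> // k b /gq; exact: g'g.
apply/seteqP; split; last exact: sub_ro_neg2.
move=> g /ro_neg2P Hg; have [g1 _ [jq _]] := Hg _ (lexx _); split=> // k b qk.
case gk: (g.[? k])%fmap => [b'|].
  have [g2 /asboolP g2g [_ /(_ _ _ qk)]] := Hg _ (lexx _).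
  by rewrite (g2g _ _ gk).
have [|g2 /asboolP g2g [_ /(_ _ _ qk)]] := Hg (g.[k <- ~~ b]%fmap : Fn (K j)).
  apply/asboolP => k' b'; rewrite fnd_set; case: eqVneq => // ->.
  by rewrite gk.
rewrite (g2g k (~~ b)); last by rewrite fnd_set eqxx.
by case: b {qk g2g}.
Qed.

Definition prod_cond_emb q : prod_algebra (fun i => cohen_algebra (K i)) :=
  fun j => mk_ro (@prod_cond_regular q j).

Lemma untag_Tagged (T : Type) (t0 : T) i (F : K i -> T) (k : K i) :
  untag t0 F (Tagged K k) = F k.
Proof.
by rewrite (untagE t0 F (erefl i : tag (Tagged K k) = i)).
Qed.

Lemma tagP i x : tag x = i -> exists k : K i, x = Tagged K k.
Proof. by case: x => j k /= <-; exists k. Qed.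

Lemma prod_neq0 (f : prod_algebra (fun i => cohen_algebra (K i))) :
  f != \bot <-> exists i g, (f i : set (Fn (K i))) g.
Proof.
split=> [nf|[i [g fg]]]; last by apply/eqP => E; rewrite E in fg.
apply: contrapT => nP; case/eqP: nf; apply: functional_extensionality_dep => i.
apply/eqP; apply: contra_notT nP => /ro_neq0[g fg]; by exists i, g.
Qed.

Lemma prod_cond_embedding :
  dense_embedding (@ext _ prod_conditions) prod_cond_emb.
Proof.
split.
- move=> q r [qr1 qr]; apply/asboolP => j; apply/ro_leP => g [jq gq].
  split=> [|k b rk]; first by rewrite -qr1.
  by apply: gq; apply: qr => //=; rewrite jq.
- move=> q; apply/prod_neq0; exists q.1.
  exists (fmap_of (pmap (untag None (@Some (K q.1))) (enum_fset (domf q.2)))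
    (fun k => q.2.[? Tagged K k]%fmap)).
  split=> // k b qk; rewrite fnd_fmap_of qk; case: ifPn => //.
  rewrite mem_pmap => /negP[]; apply/mapP; exists (Tagged K k).
    by rewrite -[_ \in _]/(_ \in domf _) mem_domf qk.
  by rewrite untag_Tagged.
- move=> f /prod_neq0[i [g fg]].
  exists (i, fmap_of (map (Tagged K) (enum_fset (domf g)))
    (untag None (fun k => g.[? k]%fmap))).
  apply/asboolP => j; apply/ro_leP => h [/= ji]; subst j => hg.
  apply: ro_down fg; apply/asboolP => k b gk; apply: hg.
  rewrite fnd_fmap_of untag_Tagged gk; case: ifPn => // /negP[].
  by apply: map_f; rewrite -[_ \in _]/(_ \in domf _) mem_domf gk.
- move=> q r /prod_neq0[j [g [[jq gq] [jr gr]]]].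
  pose s : prod_cond := (j, fmap_of (enum_fset (domf q.2) ++ enum_fset (domf r.2))
    (untag None (fun k => g.[? k]%fmap))).
  exists s; split; split=> //= x b.
    rewrite -jq => /tagP[k ->] qx; rewrite fnd_fmap_of untag_Tagged (gq _ _ qx).
    by rewrite mem_cat -[_ \in _]/(_ \in domf _) mem_domf qx.
  rewrite -jr => /tagP[k ->] qx; rewrite fnd_fmap_of untag_Tagged (gr _ _ qx).
  by rewrite mem_cat orbC -[_ \in _]/(_ \in domf _) mem_domf qx.
Qed.

End ProductConditions.

(** * Coherent families of partial functions *)

Section CoherentConditions.
Context (K : choiceType).

(** The length of the condition and the functions that it decides. The entry
    [Some v] of a list means that the partial function is defined there with
    value [v], and [None] that it is undefined there. Missing entries count as
    [None]. *)
Definition coh_cond : Type := nat * {fmap K -> seq (option bool)}.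
Implicit Types (p q r : coh_cond) (S T : set K) (s t : K).

Definition dom p : seq K := enum_fset (domf p.2).
Definition value p s n : option bool :=
  if p.2.[? s]%fmap is Some l then nth None l n else None.

Definition mk_coh (m : nat) (F : seq K) (g : K -> nat -> option bool) : coh_cond :=
  (m, fmap_of F (fun s => Some (mkseq (g s) m))).

Lemma mem_dom_mk m F g s : (s \in dom (mk_coh m F g)) = (s \in F).
Proof. by rewrite -[_ \in _]/(_ \in domf _) mem_fmap_of andbT. Qed.

Lemma value_mk m F g s n :
  value (mk_coh m F g) s n = if (s \in F) && (n < m)%N then g s n else None.
Proof.
rewrite /value fnd_fmap_of; case: ifP => //= _.
by case: ltnP => nm; [rewrite nth_mkseq|rewrite nth_default ?size_mkseq].
Qed.

(** The promise of [p] is the last clause: from the length of [p] on, the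
    functions that [p] decides do not contradict each other. Functions that are
    added later may contradict them below the new length. *)
Record coh_ext q p : Prop := CohExt {
  ext_length : (p.1 <= q.1)%N;
  ext_dom : forall s, s \in dom p -> s \in dom q;
  ext_value : forall s n, s \in dom p -> (n < p.1)%N -> value q s n = value p s n;
  ext_coherent : forall s t n, s \in dom p -> t \in dom p ->
    (p.1 <= n)%N -> (n < q.1)%N ->
    value q s n = Some true -> value q t n = Some false -> False }.

Lemma coh_ext_refl p : coh_ext p p.
Proof.
by split=> // s t n _ _ pn np; rewrite ltnNge pn in np.
Qed.

Lemma coh_ext_trans q p r : coh_ext p q -> coh_ext q r -> coh_ext p r.
Proof.
move=> [lpq dpq vpq cpq] [lqr dqr vqr cqr]; split.
- exact: leq_trans lpq.
- by move=> s /dqr /dpq.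
- move=> s n sr nr; rewrite vpq ?vqr//; first exact: dqr.
  exact: leq_trans lqr.
- move=> s t n sr tr rn np; have [nq|qn] := ltnP n q.1.
    by rewrite !vpq ?(dqr s) ?(dqr t)//; exact: cqr.
  exact: cpq (dqr _ sr) (dqr _ tr) qn np.
Qed.

Definition coh_code p : nat :=
  choice.pickle (p.1, [seq p.2.[? s]%fmap | s <- dom p]).

Lemma coh_dom_code_inj : injective (fun p => (dom p, coh_code p)).
Proof.
move=> [m f] [n g] [/= E] /(pcan_inj choice.pickleK) /= [-> H].
by congr (_, _); exact: fmap_keys_values_inj.
Qed.

Definition coh_restr S p : coh_cond :=
  mk_coh p.1 [seq s <- dom p | `[< S s >]] (value p).

Lemma mem_dom_restr S p s : (s \in dom (coh_restr S p)) = `[< S s >] && (s \in dom p).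
Proof. by rewrite mem_dom_mk mem_filter. Qed.

Lemma coh_dom_restr S p s : s \in dom (coh_restr S p) -> S s.
Proof. by rewrite mem_dom_restr => /andP[/asboolP]. Qed.

Lemma value_restr S p s n : s \in dom (coh_restr S p) -> (n < p.1)%N ->
  value (coh_restr S p) s n = value p s n.
Proof. by rewrite mem_dom_mk value_mk => -> ->. Qed.

Lemma coh_ext_restr S p : coh_ext p (coh_restr S p).
Proof.
split=> [//|s|s n sp np|s t n _ _ /= pn np].
- by rewrite mem_dom_restr => /andP[].
- by rewrite value_restr.
- by rewrite ltnNge pn in np.
Qed.

Lemma coh_restr_mono S p q : coh_ext q p ->
  (forall s, s \in dom p -> S s) -> coh_ext (coh_restr S q) p.
Proof.
move=> [l d v c] pS.
have dq s : s \in dom p -> s \in dom (coh_restr S q).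
  by move=> sp; rewrite mem_dom_restr asboolT ?d//; exact: pS.
split=> // [s n sp np|s t n sp tp pn nq].
  by rewrite value_restr ?v ?dq//; exact: leq_trans l.
by rewrite !value_restr ?dq//; exact: c.
Qed.

(** The functions outside [S] are continued as undefined, which breaks no
    promise. *)
Lemma coh_restr_amalgam S p q : coh_ext q (coh_restr S p) ->
  exists r, coh_ext r p /\ coh_ext r (coh_restr S q).
Proof.
move=> [/= l d v c].
exists (mk_coh q.1 ([seq s <- dom q | `[< S s >]] ++ dom p)
  (fun s n => if `[< S s >] then value q s n
              else if (n < p.1)%N then value p s n else None)).
split; split=> //=.
- by move=> s sp; rewrite mem_dom_mk mem_cat sp orbT.
- move=> s n sp np; rewrite value_mk mem_cat sp orbT (leq_trans np l) /= np.
  case: asboolP => // Ss; have sSp : s \in dom (coh_restr S p).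
    by rewrite mem_dom_restr asboolT.
  by rewrite v// value_restr.
- move=> s t n sp tp pn nq; rewrite !value_mk !mem_cat sp tp !orbT nq /=.
  rewrite ltnNge pn /=; case: asboolP => // Ss; case: asboolP => // St.
  by apply: c => //; rewrite mem_dom_restr asboolT.
- by move=> s; rewrite mem_dom_restr mem_dom_mk mem_cat mem_filter => ->.
- move=> s n sq nq; rewrite value_restr// value_mk mem_cat nq andbT.
  by move: sq; rewrite mem_dom_restr mem_filter => /andP[-> ->].
- by move=> s t n _ _ qn nq; rewrite ltnNge qn in nq.
Qed.

Definition coh_conditions : conditions K :=
  Conditions coh_ext_refl coh_ext_trans coh_dom_code_inj coh_dom_restr
    coh_ext_restr coh_restr_mono coh_restr_amalgam.

(** [u] promises coherence of [x_a] and [x_b] from the start. A new point is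
    added at the end of [p], where the extension over [S] defines only [x_a]
    and the extension over [T] defines only [x_b], with opposite values: both
    keep the promises of the parts of [p]. *)
Lemma coh_split S T a b : S a -> ~ T a -> T b -> ~ S b -> exists u,
  forall p, coh_ext p u -> exists p1 p2,
    [/\ (forall s, s \in dom p1 -> S s) /\ (forall s, s \in dom p2 -> T s),
        coh_ext p1 (coh_restr S p), coh_ext p2 (coh_restr T p),
        exists r, coh_ext r p1 /\ coh_ext r p2 &
        forall r, coh_ext r p1 -> coh_ext r p2 -> ~ coh_ext r u].
Proof.
move=> Sa nTa Tb nSb; exists (mk_coh 0 [:: a; b] (fun _ _ => None)) => p [_ pab _ _].
have pa : a \in dom p by apply: pab; rewrite mem_dom_mk inE eqxx.
have pb : b \in dom p by apply: pab; rewrite mem_dom_mk !inE eqxx orbT.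
have ab : (b == a) = false by apply/eqP => E; apply: nSb; rewrite E.
pose g c v s n := if (n < p.1)%N then value p s n else
  if s == c then Some v else None : option bool.
pose ext1 W c v := mk_coh p.1.+1 [seq s <- dom p | `[< W s >]] (g c v).
have ext1P W c v : coh_ext (ext1 W c v) (coh_restr W p).
  split=> [|s|s n|s t n] /=; first exact: leqnSn.
  - by rewrite !mem_dom_mk.
  - rewrite mem_dom_mk => sp np; rewrite !value_mk sp np /= (leq_trans np)//=.
    by rewrite /g np.
  - rewrite !mem_dom_mk => sp tp pn np; rewrite !value_mk sp tp np /= /g ltnNge pn /=.
    by case: eqP => // _; case: eqP => // _ [->].
have ext1_supp W c v s : s \in dom (ext1 W c v) -> W s.
  by rewrite mem_dom_mk mem_filter => /andP[/asboolP].
exists (ext1 S a false), (ext1 T b true); split => //.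
- split; exact: ext1_supp.
- pose h s n := if (n < p.1)%N then value p s n else
    if s == a then Some false else if s == b then Some true else None.
  have hP W c v : (forall s n, W s -> g c v s n = h s n) ->
      coh_ext (mk_coh p.1.+1 (dom p) h) (ext1 W c v).
    move=> gh; split=> [//|s|s n|s t n _ _ pn np].
    + by rewrite !mem_dom_mk mem_filter => /andP[].
    + move=> sp np; rewrite /= in np; rewrite !value_mk np !andbT.
      move: sp; rewrite mem_dom_mk => sp; rewrite sp; move: sp.
      by rewrite mem_filter => /andP[/asboolP Ws ->]; rewrite gh.
    + by rewrite ltnNge pn in np.
  exists (mk_coh p.1.+1 (dom p) h); split; apply: hP => s n Ws; rewrite /g /h.
    case: ifP => // _; case: eqP => // _; case: eqP => // sb.
    by case: nSb; rewrite -sb.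
  case: ifP => // _; have [sa|//] := eqVneq s a.
  by case: nTa; rewrite -sa.
- move=> r [l1 _ v1 _] [_ _ v2 _] [_ _ _ c].
  have vb : value r b p.1 = Some true.
    rewrite v2//; last by rewrite mem_dom_mk mem_filter pb asboolT.
    by rewrite value_mk mem_filter asboolT// pb ltnSn /= /g ltnn eqxx.
  have va : value r a p.1 = Some false.
    rewrite v1//; last by rewrite mem_dom_mk mem_filter pa asboolT.
    by rewrite value_mk mem_filter asboolT// pa ltnSn /= /g ltnn eqxx.
  by apply: (c b a p.1) => //; rewrite mem_dom_mk !inE eqxx ?orbT.
Qed.

End CoherentConditions.

(** The Cohen bits used to build the family: the hidden real; the domain of
    [x_s]; the bits whose first true one is the stopping time of [x_s]; the
    values of [x_s] before this time. *)
Inductive bit (K : Type) : Type :=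
  | Hidden of nat | Defined of K & nat | Stop of K & nat | Initial of K & nat.
Arguments Hidden {K}.

Section Projection.
Context (K : choiceType) (loc : bit K -> K) (loc_inj : injective loc).
Implicit Types (c : Fn K) (p q : coh_cond K) (s t : K) (b : bit K) (F : seq K).

Definition get c b : option bool := (c : {fmap K -> bool}).[? loc b]%fmap.

Definition stopped c s n : bool :=
  has (fun j => get c (Stop s j) == Some true) (iota 0 n.+1).

Definition read c s n : option bool :=
  if get c (Defined s n) == Some true then
    Some (get c (if stopped c s n then Hidden n else Initial s n) == Some true)
  else None.

Definition in_rectangle F m b : bool := match b with
  | Hidden n => (n < m)%N
  | Defined s n | Stop s n | Initial s n => (s \in F) && (n < m)%N
  end.

(** The rectangle makes the length and the domain of the image depend on [c]
    only. All stopping times are below the length, so that from there on the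
    functions are restrictions of the hidden real: the promise of the image. *)
Record coh_proj c p : Prop := CohProj {
  coh_proj_rectangle : forall b, isSome (get c b) = in_rectangle (dom p) p.1 b;
  coh_proj_stopped : forall s, s \in dom p ->
    exists2 n, (n < p.1)%N & get c (Stop s n) = Some true;
  coh_proj_value : forall s n, s \in dom p -> (n < p.1)%N -> value p s n = read c s n }.

Lemma get_mono c c' b v : c' <= c -> get c b = Some v -> get c' b = Some v.
Proof. by move=> /asboolP; exact. Qed.

Lemma get_eq c c' b : c' <= c -> isSome (get c b) -> get c' b = get c b.
Proof. by move=> c'c; case E: (get c b) => [v|//] _; exact: get_mono E. Qed.

Lemma stoppedP c s n :
  reflect (exists2 j, (j <= n)%N & get c (Stop s j) = Some true) (stopped c s n).
Proof.
apply: (iffP hasP) => [[j]|[j jn /eqP cj]].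
  by rewrite mem_iota /= => jn /eqP cj; exists j.
by exists j => //; rewrite mem_iota.
Qed.

Lemma read_eq c c' p s n : c' <= c -> coh_proj c p -> s \in dom p ->
  (n < p.1)%N -> read c' s n = read c s n.
Proof.
move=> c'c cp sp np; have rect := coh_proj_rectangle cp.
have -> // : read c' s n = read c s n.
rewrite /read (get_eq c'c) ?rect /= ?sp//.
have -> : stopped c' s n = stopped c s n.
  apply: eq_in_has => j; rewrite mem_iota /= ltnS => jn.
  by rewrite (get_eq c'c)// rect /= sp (leq_ltn_trans jn np).
by rewrite (get_eq c'c)// rect; case: ifP => //= _; rewrite sp.
Qed.

Lemma stopped_late c p s n : coh_proj c p -> s \in dom p -> (p.1 <= n)%N ->
  stopped c s n.
Proof.
move=> cp sp pn; have [j jp cj] := coh_proj_stopped cp sp.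
by apply/stoppedP; exists j => //; exact: ltnW (leq_trans jp pn).
Qed.

Lemma stopped_mono c c' s n : c' <= c -> stopped c s n -> stopped c' s n.
Proof.
by move=> c'c /stoppedP[j jn cj]; apply/stoppedP; exists j => //; exact: get_mono cj.
Qed.

(** Beyond the length of [p], all the functions that [p] decides read the hidden
    real. *)
Lemma coh_proj_mono c c' p p' :
  c' <= c -> coh_proj c p -> coh_proj c' p' -> coh_ext p' p.
Proof.
move=> c'c cp cp'.
have rect b : in_rectangle (dom p) p.1 b -> in_rectangle (dom p') p'.1 b.
  rewrite -(coh_proj_rectangle cp) -(coh_proj_rectangle cp').
  by case E: (get c b) => [v|//] _; rewrite (get_mono c'c E).
have dpp' s : s \in dom p -> s \in dom p'.
  move=> sp; have [n np _] := coh_proj_stopped cp sp.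
  by have := rect (Defined s n); rewrite /= sp np => /(_ isT)/andP[].
have lpp' : (p.1 <= p'.1)%N.
  by case E: p.1 => [//|n]; have := rect (Hidden n); rewrite /= E ltnSn; apply.
split=> // [s n sp np|s t n sp tp pn np].
  rewrite (coh_proj_value cp')//; [|exact: dpp'|exact: leq_trans lpp'].
  by rewrite (coh_proj_value cp)// (read_eq c'c cp).
rewrite !(coh_proj_value cp') ?dpp'// /read.
rewrite !(stopped_mono c'c (stopped_late cp _ pn))//.
by case: eqP => // _ [->]; case: eqP.
Qed.

(** [fill] completes [c] on a rectangle, with the default values [g]. *)
Section Fill.
Variables (c : Fn K) (F : seq K) (m : nat) (g : bit K -> bool).

Definition rectangle_keys : seq K :=
  [seq loc (Hidden n) | n <- iota 0 m] ++
  [seq loc (Defined s n) | s <- F, n <- iota 0 m] ++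
  [seq loc (Stop s n) | s <- F, n <- iota 0 m] ++
  [seq loc (Initial s n) | s <- F, n <- iota 0 m].

Lemma mem_rectangle_keys b : (loc b \in rectangle_keys) = in_rectangle F m b.
Proof.
rewrite !mem_cat; apply/or4P/idP.
- by case=> [/mapP[n + /loc_inj->]|/allpairsP[[s n] [/= sF + /loc_inj->]]
    |/allpairsP[[s n] [/= sF + /loc_inj->]]|/allpairsP[[s n] [/= sF + /loc_inj->]]];
    rewrite /= mem_iota /= ?sF.
- case: b => [n|s n|s n|s n] /= => [nm|/andP[sF nm]|/andP[sF nm]|/andP[sF nm]].
  + by apply: Or41; apply/mapP; exists n; rewrite ?mem_iota.
  + by apply: Or42; apply/allpairsP; exists (s, n); rewrite ?mem_iota.
  + by apply: Or43; apply/allpairsP; exists (s, n); rewrite ?mem_iota.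
  + by apply: Or44; apply/allpairsP; exists (s, n); rewrite ?mem_iota.
Qed.

Definition fill : Fn K :=
  fmap_of (enum_fset (domf c) ++ rectangle_keys) (fun k =>
    if c.[? k]%fmap is Some v then Some v
    else Some `[< exists b, loc b = k /\ g b >]).

Lemma get_fill b : get fill b =
  if get c b is Some v then Some v
  else if in_rectangle F m b then Some (g b) else None.
Proof.
rewrite /get fnd_fmap_of mem_cat mem_rectangle_keys.
rewrite -[_ \in enum_fset _]/(_ \in domf _) mem_domf.
case: (c.[? loc b])%fmap => [v|] //=; case: ifP => // _; congr Some.
by apply/asboolP/idP => [[b' [/loc_inj->]]|gb]//; exists b.
Qed.

Lemma fill_le : fill <= c.
Proof.
apply/asboolP => k v ck; rewrite fnd_fmap_of ck mem_cat.
by rewrite -[_ \in enum_fset _]/(_ \in domf _) mem_domf ck.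
Qed.

End Fill.

(** The rectangle has one more column than needed for [c]; there the bits [Stop]
    are free, and setting them stops every function below the new length. *)
Lemma fill_proj c F m (g : bit K -> bool) :
  (forall b, isSome (get c b) -> in_rectangle F m b) ->
  (forall s, g (Stop s m)) ->
  coh_proj (fill c F m.+1 g) (mk_coh m.+1 F (read (fill c F m.+1 g))).
Proof.
move=> cF gm; split=> [b|s|s n].
- have -> : in_rectangle (dom (mk_coh m.+1 F (read (fill c F m.+1 g)))) m.+1 b =
      in_rectangle F m.+1 b by case: b => //= *; rewrite mem_dom_mk.
  rewrite get_fill; case E: (get c b) => [v|] /=; last by case: ifP.
  have := cF b; rewrite E => /(_ isT).
  by case: b E => //= [n|s n|s n|s n] _ => [/ltnW//|/andP[-> /ltnW]//|
    /andP[-> /ltnW]//|/andP[-> /ltnW]//].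
- rewrite mem_dom_mk => sF; exists m; first exact: ltnSn.
  rewrite get_fill /= sF ltnSn gm; case E: (get c _) => [v|//].
  by have := cF (Stop s m); rewrite E /= ltnn andbF => /(_ isT).
- by rewrite mem_dom_mk => sF nm; rewrite value_mk sF nm.
Qed.

(** Every finite condition is contained in a rectangle. *)
Lemma coh_proj_dense c : exists c' p, c' <= c /\ coh_proj c' p.
Proof.
have [pre preK] : exists pre : K -> bit K, cancel loc pre.
  have /choice[pre preP] : forall k, exists b, (exists b', loc b' = k) -> loc b = k.
    move=> k; have [[b bk]|nb] := pselect (exists b', loc b' = k); first by exists b.
    by exists (Hidden 0).
  by exists pre => b; apply: loc_inj; apply: preP; exists b.
pose sort b := match b with Hidden _ => None
  | Defined s _ | Stop s _ | Initial s _ => Some s end.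
pose index b := match b with Hidden n
  | Defined _ n | Stop _ n | Initial _ n => n end.
pose F := pmap (fun k => sort (pre k)) (enum_fset (domf c)).
pose m := (\max_(k <- enum_fset (domf c)) index (pre k)).+1.
have cF b : isSome (get c b) -> in_rectangle F m b.
  rewrite /get -mem_domf => bc.
  have bm : (index b < m)%N.
    rewrite /m ltnS -{1}(preK b).
    exact: (leq_bigmax_seq (F := fun k => index (pre k)) (loc b)).
  have bF s : sort b = Some s -> s \in F.
    by move=> bs; rewrite mem_pmap; apply/mapP; exists (loc b); rewrite ?preK.
  by case: b bc bm bF => //= [s n|s n|s n] _ -> ->.
exists (fill c F m.+1 (fun=> true)), (mk_coh m.+1 F (read (fill c F m.+1 (fun=> true)))).
by split; [exact: fill_le|exact: fill_proj].
Qed.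

(** New values of old functions are coherent, so that they determine the hidden
    bits; the functions that are new in [p'] are not stopped below its length,
    so that they take their values from the bits [Initial]. *)
Lemma coh_proj_lift c p p' : coh_proj c p -> coh_ext p' p ->
  exists c' p'', [/\ c' <= c, coh_proj c' p'' & coh_ext p'' p'].
Proof.
move=> cp [l d v co].
pose g b := match b with
  | Hidden n => `[< exists2 s, s \in dom p & value p' s n = Some true >]
  | Defined s n => (n < p'.1)%N && isSome (value p' s n)
  | Stop s n => n == p'.1
  | Initial s n => value p' s n == Some true
  end.
pose c' := fill c (dom p') p'.1.+1 g.
have c'c : c' <= c by exact: fill_le.
have cF b : isSome (get c b) -> in_rectangle (dom p') p'.1 b.
  rewrite (coh_proj_rectangle cp).
  by case: b => /= [n|s n|s n|s n] => [np|/andP[sp np]|/andP[sp np]|/andP[sp np]];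
    rewrite ?d// (leq_trans np).
exists c', (mk_coh p'.1.+1 (dom p') (read c')); split => //.
  by apply: fill_proj => // s; exact: eqxx.
have outside b : in_rectangle (dom p') p'.1.+1 b ->
    ~~ in_rectangle (dom p) p.1 b -> get c' b = Some (g b).
  by rewrite get_fill -(coh_proj_rectangle cp); case: (get c b) => //= ->.
split=> [||s n sp' np'|s t n sp' tp' /= pn np'].
- exact: leqnSn.
- by move=> s; rewrite mem_dom_mk.
- rewrite value_mk sp' (leq_trans np' (leqnSn _)) /=.
  have np'S : (n < p'.1.+1)%N := leq_trans np' (leqnSn _).
  have [sp|nsp] := boolP (s \in dom p); last first.
    rewrite /read outside /= ?sp' ?(negPf nsp)// np' /=.
    have -> : stopped c' s n = false.
      apply/stoppedP => -[j jn]; have jp' := leq_ltn_trans jn np'.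
      rewrite outside /= ?sp' ?(negPf nsp) ?(leqW jp')// => -[/eqP E].
      by rewrite E ltnn in jp'.
    rewrite outside /= ?sp' ?(negPf nsp)//.
    by case: (value p' s n) => [[]|].
  have [np|pn] := ltnP n p.1.
    by rewrite (read_eq c'c cp)// v// (coh_proj_value cp).
  have nnp : (n < p.1)%N = false by rewrite ltnNge pn.
  rewrite /read (stopped_mono c'c (stopped_late cp sp pn)).
  rewrite !outside /= ?nnp ?andbF ?sp'// np' /=.
  case E: (value p' s n) => [w|//] /=; congr Some.
  apply/eqP/idP => [[/asboolP[t tp Et]]|w1].
    by case: w E => // E; case: (co t s n tp sp pn np' Et E).
  by congr Some; apply/asboolP; exists s; rewrite // E w1.
- move: np'; rewrite ltnS => np'; have En : n = p'.1 by apply/eqP; rewrite eqn_leq np' pn.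
  rewrite value_mk sp' ltnS np' /= /read outside /= ?sp' ?ltnS//.
    by rewrite En ltnn.
  by rewrite negb_and -leqNgt (leq_trans l pn) orbT.
Qed.

Lemma coh_projection : projection (@coh_ext K) coh_proj.
Proof.
split.
- by move=> q p r; exact: coh_ext_trans.
- exact: coh_proj_dense.
- exact: coh_proj_mono.
- exact: coh_proj_lift.
- move=> p.
  have c0 : coh_proj ([fmap]%fmap : Fn K) (0, [fmap]%fmap).
    by split=> // -[n|s n|s n|s n]; rewrite /get fnd_fmap0 //= andbF.
  have [|c [p' [_ cp' p'p]]] := coh_proj_lift (p' := p) c0; last by exists c, p'.
  by split.
Qed.

End Projection.

(** * The pi-weight and the main result *)

Lemma bit_inj (K : Type) : infinite_set [set: K] ->
  exists loc : bit K -> K, injective loc.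
Proof.
move=> Kinf; have [i iinj] := infinite_nat_inj Kinf.
have [f finj] := infinite_square_inj Kinf.
exists (fun b => match b with
  | Hidden n => f (i 0, i n)
  | Defined s n => f (i 1, f (s, i n))
  | Stop s n => f (i 2, f (s, i n))
  | Initial s n => f (i 3, f (s, i n)) end).
case=> [m|s m|s m|s m] [n|t n|t n|t n] /finj[] => [/iinj->|/iinj|/iinj|/iinj
  |/iinj|/finj[-> /iinj->]|/iinj|/iinj|/iinj|/iinj|/finj[-> /iinj->]|/iinj
  |/iinj|/iinj|/iinj|/finj[-> /iinj->]] //.
Qed.

Section PiWeight.
Context (K : choiceType) (K_infinite : infinite_set [set: K]).
Context d (D : ctbDistrLatticeType d) (e : coh_cond K -> D).
Hypothesis eP : dense_embedding (@coh_ext K) e.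

(** Below an element [x] of the dense set choose a coherent condition [h x]. If
    [x] decides [x_s] at [0], then [s] is one of the finitely many indices of
    [h x]; thus [K] injects into the product of the dense set with [nat]. *)
Lemma coh_dense_ge (A : set D) : dense_in A -> [set: K] #<= A.
Proof.
move=> Adense.
pose v (s : K) := mk_coh 1 [:: s] (fun _ _ => Some true).
have /choice[h hP] : forall x : D, exists p, x != \bot -> e p <= x.
  move=> x; have [->|/(emb_dense eP)[p px]] := eqVneq x \bot.
    by exists (0, [fmap]%fmap).
  by exists p.
have /choice[u uP] : forall s, exists x, [/\ A x, x != \bot & x <= e (v s)].
  move=> s; have [x [Ax x0 xs]] := Adense _ (emb_neq0 eP (v s)).
  by exists x; split; rewrite -?lt0x.
have hu s : s \in dom (h (u s)).
  have [_ us0 us] := uP s; have hus := le_trans (hP _ us0) us.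
  apply: contraT => nsh.
  (* Otherwise [h (u s)] is compatible with the opposite decision. *)
  pose w := mk_coh (maxn 1 (h (u s)).1) [:: s] (fun _ _ => Some false).
  have nsr x : x \in dom (coh_restr [set s] (h (u s))) = false.
    rewrite mem_dom_restr; apply/negP => /andP[/asboolP/= -> sh].
    by rewrite sh in nsh.
  have [|z [zh zw]] := @coh_restr_amalgam _ [set s] (h (u s)) w.
    by split=> [|x|x n|x y n]; rewrite ?nsr// leq_maxr.
  have zw' : coh_ext z w.
    apply: coh_ext_trans zw _; apply: coh_restr_mono (coh_ext_refl _) _ => x.
    by rewrite mem_dom_mk inE => /eqP.
  have [|y [yz yv]] := emb_compat eP (p := z) (q := v s).
    rewrite (meet_l (le_trans (emb_mono eP zh) hus)); exact: (emb_neq0 eP).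
  have yw := coh_ext_trans yz zw'.
  have := ext_value yw (s := s) (n := 0); rewrite mem_dom_mk inE eqxx /= leq_maxl.
  rewrite (ext_value yv) ?mem_dom_mk ?inE// !value_mk inE eqxx /= leq_maxl.
  by move=> /(_ isT isT).
have Ainf : infinite_set A.
  move=> Afin; apply: K_infinite.
  apply: (@sub_finite_set _ _ (\bigcup_(x in A) [set` dom (h x)])).
    by move=> s _; exists (u s) => //=; have [] := uP s.
  by apply: bigcup_finite => // x _; exact: finite_seq.
have {}Ainf : infinite_set [set: A].
  apply/infiniteP; rewrite (card_le_eqr (card_setT _)).
  exact/infiniteP.
have [f finj] := infinite_square_inj Ainf.
have [i iinj] := infinite_nat_inj Ainf.
rewrite -(card_le_eqr (card_setT _)).
have uA s : A (u s) by have [] := uP s.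
apply: (card_le_of_inj (f := fun s =>
  f (SigSub (mem_set (uA s)), i (index s (dom (h (u s))))))) => // s t _ _.
move=> /finj[Eu /iinj Ei]; rewrite -(nth_index s (hu s)) Ei Eu.
by rewrite (set_nth_default t) ?nth_index// index_mem.
Qed.

Lemma coh_pi_weight : is_pi_weight D [set: K].
Proof.
split; last exact: coh_dense_ge.
have edense : dense_in (range e).
  move=> x /(emb_dense eP)[p px]; exists (e p); split => //.
  by rewrite lt0x; exact: (emb_neq0 eP).
exists (range e); split => //; rewrite card_eq_le coh_dense_ge// andbT.
apply: card_le_trans (card_image_le _ _) _.
have [f finj] := infinite_seq_inj K_infinite.
apply: (card_le_of_inj (f := fun p => f (dom p, coh_code p))) => // p q _ _.
by move=> /finj; exact: coh_dom_code_inj.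
Qed.

End PiWeight.

Theorem mainTheorem1 (K : choiceType) (hK : omega2_le [set: K]) :
  exists B : subalgebra (cohen_algebra K),
    [/\ complete_algebra (subalg B),
        regular_subalgebra B,
        is_pi_weight (subalg B) [set: K] &
        ~ is_cohen (subalg B)].
Proof.
have Kinf := omega2_le_infinite hK.
have [loc loc_inj] := bit_inj Kinf.
have projK := coh_projection loc_inj.
have embK := projected_cond_embedding projK.
exists (projected_subalgebra projK); split.
- exact: projected_complete.
- exact: projected_regular.
- exact (coh_pi_weight Kinf embK).
- move=> [I [L [_ iso]]].
  have [e eP] := completion_embedding embK.
  have [f fP] := isomorphic_embedding iso eP.
  apply: (@no_common_completion _ _ (coh_conditions K) _ _ _ _ fP _
    (prod_cond_embedding L)) => //.
    exact: coh_split.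
  exact: prod_amalgam.
Qed.
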